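(* Let $n$ be a positive integer. Put $G=GL(n,\mathbb{R})\ltimes\mathbb{R}^n$ and $H=GL(n,\mathbb{R})\subset G$. Let $\rho\colon G\to GL(\mathrm{Sym}(n+1,\mathbb{R}))$ be the representation given by $$\rho(g)(S):=\begin{pmatrix}A&b\\0&1\end{pmatrix}S\begin{pmatrix}A&b\\0&1\end{pmatrix}^{T}\qquad(g=(A,b)\in GL(n,\mathbb{R})\ltimes\mathbb{R}^n,\ S\in\mathrm{Sym}(n+1,\mathbb{R})).$$ Then $v_0:=E_{n+1,n+1}\in\mathrm{Sym}(n+1,\mathbb{R})$ is $H$-fixed, and the family $\mathcal{P}$ obtained from $(G,H,\mathrm{Sym}(n+1,\mathbb{R}),v_0)$ by the method described in the context, under the identification $G/H\simeq\mathbb{R}^n$, $(A,b)H\mapsto b$, is the family of multivariate normal distributions on $\mathbb{R}^n$, $$\left\{\frac{1}{\sqrt{(2\pi)^n\det\Sigma}}\exp\left(-\tfrac12(x-\mu)^{T}\Sigma^{-1}(x-\mu)\right)dx\right\}_{(\Sigma,\mu)\in\mathrm{Sym}^+(n,\mathbb{R})\times\mathbb{R}^n}.$$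
   Context: $\mathrm{Sym}(m,\mathbb{R})$ is the space of real symmetric $m\times m$ matrices, $\mathrm{Sym}^+(n,\mathbb{R})$ the set of positive definite symmetric matrices of size $n$, $E_{ij}$ the matrix units. $GL(n,\mathbb{R})\ltimes\mathbb{R}^n$ is the affine group with product $(A,b)(A',b')=(AA',Ab'+b)$; $H=\{(A,0)\}$. $dx$ is Lebesgue measure. The method: let $G$ be a Lie group with finitely many connected components, $H$ a closed subgroup, $X:=G/H$, $\rho\colon G\to GL(V)$ a continuous finite dimensional real representation and $v_0\in V$ an $H$-fixed vector. Put $W_0(G,H):=\{\tau\colon G\to\mathbb{R}\mid\tau\text{ is a continuous group homomorphism with }\tau|_H=0\}$. Take a nonzero relatively $G$-invariant Radon measure $\nu$ on $X$ (i.e. for some $\chi\colon G\to\mathbb{R}_{>0}$ the pushforward satisfies $g\cdot\nu=\chi(g)^{-1}\nu$ for all $g\in G$), assumed to exist; the resulting family does not depend on the choice of $\nu$. For $\theta=(\varphi,\tau)\in V^\vee\times W_0(G,H)$ and $x=gH$, put $\rho(x)v_0:=\rho(g)v_0$, $\tau(x):=\tau(g)$ and $d\tilde p_\theta(x):=\exp(-\langle\varphi,\rho(x)v_0\rangle+\tau(x))\,d\nu(x)$. Let $\Theta:=\{\theta\in V^\vee\times W_0(G,H)\mid\int_Xd\tilde p_\theta<\infty\}$ and, for $\theta\in\Theta$, $p_\theta:=(\int_Xd\tilde p_\theta)^{-1}\tilde p_\theta$. The family obtained is the set $\mathcal{P}:=\{p_\theta\}_{\theta\in\Theta}$ of probability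 measures on $X$. *)

(* Defs.v *)
From HB Require Import structures.
From mathcomp Require Import all_boot all_order all_algebra.
From mathcomp Require Import all_classical all_reals all_analysis measurable_realfun.

Set Implicit Arguments.
Unset Strict Implicit.
Unset Printing Implicit Defensive.
Import Order.TTheory GRing.Theory Num.Theory.
Import numFieldNormedType.Exports.
Local Open Scope classical_set_scope.
Local Open Scope ring_scope.
Local Open Scope quotient_scope.

(* Only the topological group structure of a Lie group enters the construction
   below. *)
HB.mixin Record isTopologicalGroup G of Group G & PointedTopological G := {
  mulg_continuous : continuous (fun xy : G * G => (xy.1 * xy.2)%g);
  invg_continuous : continuous (fun x : G => (x^-1)%g)
}.

#[short(type="topGroupType")]
HB.structure Definition TopologicalGroup :=
  {G of isTopologicalGroup G & Group G & PointedTopological G}.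

Section Homogeneous.
Context (G : topGroupType) (H : groupClosed G).

(* x ~ y iff xH = yH *)
Definition lcoset_rel : rel G := fun x y => (x^-1 * y)%g \in H.

Lemma lcoset_rel_refl : reflexive lcoset_rel.
Proof. by move=> x; rewrite /lcoset_rel mulVg gpred1. Qed.

Lemma lcoset_rel_sym : symmetric lcoset_rel.
Proof. by move=> x y; rewrite /lcoset_rel -gpredV invgM invgK. Qed.

Lemma lcoset_rel_trans : transitive lcoset_rel.
Proof.
move=> y x z; rewrite /lcoset_rel => xy yz.
by have := gpredM _ _ xy yz; rewrite -mulgA mulVKg.
Qed.

Canonical lcoset_equiv :=
  EquivRel lcoset_rel lcoset_rel_refl lcoset_rel_sym lcoset_rel_trans.

(* G/H; repr chooses a representative g of gH *)
Definition homspace : Type := quotient_topology {eq_quot lcoset_equiv}.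

HB.instance Definition _ := PointedTopological.on homspace.
HB.instance Definition _ := Quotient.on homspace.

(* gH |-> (g'g)H *)
Definition homspace_act (g : G) (x : homspace) : homspace :=
  \pi_homspace (g * repr x)%g.

End Homogeneous.

Definition borel (T : ptopologicalType) := g_sigma_algebraType (@open T).

HB.instance Definition _ (T : ptopologicalType) := Measurable.on (borel T).

Section Radon.
Context (R : realType) (T : ptopologicalType).
Implicit Type mu : {measure set (borel T) -> \bar R}.

Definition radon mu :=
  [/\ forall K : set T, compact K -> (mu K < +oo)%E,
      forall A : set (borel T), measurable A ->
        mu A = ereal_inf [set mu U | U in [set U : set T | open U /\ A `<=` U]]
    & forall U : set T, open U ->
        mu U = ereal_sup [set mu K | K in [set K : set T | compact K /\ K `<=` U]]].

End Radon.

Section Method.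
Context (R : realType) (G : topGroupType) (H : groupClosed G) (V : vectType R).
Context (rho : G -> 'End(V)) (v0 : V).
Local Notation X := (homspace H).
Implicit Type nu : {measure set (borel X) -> \bar R}.
Implicit Type theta : 'Hom(V, R^o) * (G -> R).
Local Open Scope ereal_scope.

(* Continuity is that of the matrix coefficients, which define the topology of
   'End(V) as V is finite dimensional. *)
Definition continuous_representation :=
  [/\ rho 1%g = \1%VF,
      forall g h : G, rho (g * h)%g = (rho g \o rho h)%VF
    & forall (phi : 'Hom(V, R^o)) (v : V), continuous (fun g => phi (rho g v) : R)].

Definition fixed_vector := forall h : G, h \in H -> rho h v0 = v0.

(* g . nu = chi(g)^-1 nu, where g . nu is the image of nu by x |-> gx *)
Definition relatively_invariant nu :=
  exists2 chi : G -> R, (forall g, (0 < chi g)%R) &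
    forall (g : G) (A : set (borel X)), measurable A ->
      pushforward nu (homspace_act g : borel X -> borel X) A =
      ((chi g)^-1)%:E * nu A.

Definition admissible nu :=
  [/\ nu setT != 0, radon nu & relatively_invariant nu].

Definition W0 : set (G -> R) :=
  [set tau | [/\ continuous tau,
                 forall x y : G, tau (x * y)%g = (tau x + tau y)%R
               & forall h : G, h \in H -> tau h = 0%R]].

(* When v0 is H-fixed and theta.2 is in W0, the value at gH does not depend on
   the representative of gH. *)
Definition density theta (x : X) : R :=
  expR (- theta.1 (rho (repr x) v0) + theta.2 (repr x)).

Definition unnormalized nu theta (A : set (borel X)) : \bar R :=
  \int[nu]_(x in A) (density theta x)%:E.

Definition Theta nu : set ('Hom(V, R^o) * (G -> R)) :=
  [set theta | W0 theta.2 /\ unnormalized nu theta setT < +oo].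

(* The condition is on Borel sets only, as the value of a bundled measure on
   other sets is arbitrary. *)
Definition method_family nu : set {measure set (borel X) -> \bar R} :=
  [set p | exists2 theta, Theta nu theta &
    forall A : set (borel X), measurable A ->
      p A = ((fine (unnormalized nu theta setT))^-1)%:E * unnormalized nu theta A].

End Method.

Section MatrixContinuity.
Context (R : realType) (T : topologicalType).

Lemma mx_continuousP m n (f : T -> 'M[R]_(m, n)) :
  (forall i j, continuous (fun t => f t i j)) -> continuous f.
Proof.
move=> cf t U [P nP PU].
have {}PU : [set x | forall i j, P i j (f x i j)] `<=` f @^-1` U.
  by move=> x Px; apply: PU.
apply: (filterS PU).
apply: filter_forall => i; apply: filter_forall => j.
exact: cf.
Qed.

Lemma mulmx_continuous m n p (f : T -> 'M[R]_(m, n)) (g : T -> 'M[R]_(n, p)) :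
  continuous f -> continuous g -> continuous (fun t => f t *m g t).
Proof.
move=> cf cg; apply: mx_continuousP => i j.
rewrite (_ : (fun t => _) = (fun t => \sum_k f t i k * g t k j)); last first.
  by apply/funext => t; rewrite mxE.
apply: continuous_big => [|k _]; first exact: add_continuous.
move=> t; apply: cvgM.
  exact: (continuous_comp (cf t) (@coord_continuous _ _ _ i k _)).
exact: (continuous_comp (cg t) (@coord_continuous _ _ _ k j _)).
Qed.

Lemma det_continuous n (f : T -> 'M[R]_n) :
  (forall i j, continuous (fun t => f t i j)) -> continuous (fun t => \det (f t)).
Proof.
move=> cf; rewrite /determinant.
apply: continuous_big => [|s _]; first exact: add_continuous.
move=> t; apply: cvgM; first exact: cvg_cst.
by apply: continuous_big => [|i _]; [exact: mul_continuous|exact: cf].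
Qed.

Lemma invmx_continuous n (f : T -> 'M[R]_n) : (forall t, f t \in unitmx) ->
  continuous f -> continuous (fun t => invmx (f t)).
Proof.
move=> uf cf.
have cfij i j : continuous (fun t => f t i j).
  by move=> t; exact: (continuous_comp (cf t) (@coord_continuous _ _ _ i j _)).
apply: mx_continuousP => i j.
rewrite (_ : (fun t => _) = (fun t => (\det (f t))^-1 * cofactor (f t) j i)).
  move=> t; apply: cvgM.
    by apply: cvgV; [rewrite -unitfE -unitmxE|exact: det_continuous].
  apply: cvgM; first exact: cvg_cst.
  apply: det_continuous => k l; rewrite [X in continuous X](_ : _ =
    (fun t => f t (lift j k) (lift i l))); first exact: cfij.
  by apply/funext => u; rewrite !mxE.
by apply/funext => t; rewrite /invmx uf !mxE.
Qed.

End MatrixContinuity.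

Section Affine.
Context (R : realType) (n : nat).

(* GL(n, R) |>< R^n, as pairs (A, b) with A invertible *)
Record affine := Affine {
  affine_val : 'M[R]_n * 'cV[R]_n;
  _ : affine_val.1 \in unitmx
}.

HB.instance Definition _ := [isSub for affine_val].
HB.instance Definition _ := [Choice of affine by <:].

Definition aff_lin (g : affine) : 'M[R]_n := (affine_val g).1.
Definition aff_trans (g : affine) : 'cV[R]_n := (affine_val g).2.

Lemma lin_unit g : aff_lin g \in unitmx. Proof. exact: (valP g). Qed.

Definition affine_one : affine := @Affine (1%:M, 0) (unitmx1 _ _).

Lemma affine_mul_subproof (g h : affine) : aff_lin g *m aff_lin h \in unitmx.
Proof. by rewrite unitmx_mul !lin_unit. Qed.

Definition affine_mul (g h : affine) : affine :=
  @Affine (aff_lin g *m aff_lin h, aff_lin g *m aff_trans h + aff_trans g) (affine_mul_subproof g h).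

Lemma affine_inv_subproof (g : affine) : invmx (aff_lin g) \in unitmx.
Proof. by rewrite unitmx_inv lin_unit. Qed.

Definition affine_inv (g : affine) : affine :=
  @Affine (invmx (aff_lin g), - (invmx (aff_lin g) *m aff_trans g)) (affine_inv_subproof g).

Lemma affine_eq (g h : affine) : aff_lin g = aff_lin h -> aff_trans g = aff_trans h -> g = h.
Proof.
by move=> gh1 gh2; apply/val_inj; rewrite /= (surjective_pairing (affine_val g))
   (surjective_pairing (affine_val h)); congr pair.
Qed.

Lemma affine_mulA : associative affine_mul.
Proof.
by move=> f g h; apply: affine_eq; rewrite /aff_lin /aff_trans /=
  ?mulmxA // mulmxDr mulmxA addrA.
Qed.

Lemma affine_mul1 : left_id affine_one affine_mul.
Proof. by move=> g; apply: affine_eq; rewrite /aff_lin /aff_trans /= !mul1mx ?addr0. Qed.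

Lemma affine_mulr1 : right_id affine_one affine_mul.
Proof.
by move=> g; apply: affine_eq; rewrite /aff_lin /aff_trans /= ?mulmx1 // mulmx0 add0r.
Qed.

Lemma affine_mulV : left_inverse affine_one affine_inv affine_mul.
Proof.
move=> g; apply: affine_eq; rewrite /aff_lin /aff_trans /=.
  by rewrite mulVmx // lin_unit.
by rewrite subrr.
Qed.

Lemma affine_mulrV : right_inverse affine_one affine_inv affine_mul.
Proof.
move=> g; apply: affine_eq; rewrite /aff_lin /aff_trans /= ?mulmxV ?lin_unit //.
by rewrite mulmxN mulmxA mulmxV ?lin_unit // mul1mx addNr.
Qed.

HB.instance Definition _ := isGroup.Build affine
  affine_mulA affine_mul1 affine_mulr1 affine_mulV affine_mulrV.

HB.instance Definition _ := isPointed.Build affine affine_one.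
HB.instance Definition _ := Topological.copy affine (initial_topology affine_val).

Lemma affine_val_continuous : continuous affine_val.
Proof. exact: initial_continuous. Qed.

Lemma lin_continuous : continuous aff_lin.
Proof.
by move=> g; apply: (continuous_comp (@affine_val_continuous g)); exact: cvg_fst.
Qed.

Lemma trans_continuous : continuous aff_trans.
Proof.
by move=> g; apply: (continuous_comp (@affine_val_continuous g)); exact: cvg_snd.
Qed.

Lemma affine_continuous (T : topologicalType) (f : T -> affine) :
  continuous (aff_lin \o f) -> continuous (aff_trans \o f) -> continuous f.
Proof.
move=> cl ct; apply: continuous_comp_initial => t /=.
rewrite (_ : affine_val \o f = fun t => ((aff_lin \o f) t, (aff_trans \o f) t)).
  exact: (cvg_pair (cl t) (ct t)).
by apply/funext => u /=; rewrite -surjective_pairing.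
Qed.

Lemma affine_mul_continuous :
  continuous (fun gh : affine * affine => (gh.1 * gh.2)%g).
Proof.
have cl1 : continuous (fun gh : affine * affine => aff_lin gh.1).
  by move=> gh; apply: (continuous_comp cvg_fst); exact: lin_continuous.
apply: affine_continuous.
  apply: (mulmx_continuous cl1) => gh.
  by apply: (continuous_comp cvg_snd); exact: lin_continuous.
move=> gh; apply: cvgD; last first.
  by apply: (continuous_comp cvg_fst); exact: trans_continuous.
apply: (mulmx_continuous cl1) => {}gh.
by apply: (continuous_comp cvg_snd); exact: trans_continuous.
Qed.

Lemma affine_inv_continuous : continuous (fun g : affine => (g^-1)%g).
Proof.
have ci : continuous (fun g : affine => invmx (aff_lin g)).
  by apply: invmx_continuous; [exact: lin_unit|exact: lin_continuous].
apply: affine_continuous; first exact: ci.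
have cm := mulmx_continuous ci trans_continuous.
by move=> g; exact: (cvgN (cm g)).
Qed.

HB.instance Definition _ :=
  isTopologicalGroup.Build affine affine_mul_continuous affine_inv_continuous.

Definition GLsub : {pred affine} := [pred g | aff_trans g == 0].

Lemma GLsub1 : 1%g \in GLsub. Proof. by rewrite inE. Qed.

Lemma GLsubM : mulg_closed GLsub.
Proof.
by move=> g h; rewrite !inE => /eqP g0 /eqP h0; rewrite /aff_trans /= h0 g0 mulmx0 addr0.
Qed.

Lemma GLsubV : invg_closed GLsub.
Proof.
by move=> g; rewrite !inE => /eqP g0; rewrite /aff_trans /= g0 mulmx0 oppr0.
Qed.

HB.instance Definition _ := isInvClosed.Build affine GLsub GLsubV.
HB.instance Definition _ := isMulClosed.Build affine GLsub GLsubM.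
HB.instance Definition _ := isMul1Closed.Build affine GLsub GLsub1.

(* (A, b)H |-> b; by the lemmas below it does not depend on the representative
   and is a homeomorphism from G/H to R^n *)
Definition homspace_trans (x : homspace GLsub) : 'cV[R]_n := aff_trans (repr x).

Lemma homspace_transE g : homspace_trans (\pi_(homspace GLsub) g) = aff_trans g.
Proof.
rewrite /homspace_trans; case: piP => h /eqmodP /=; rewrite /lcoset_rel inE.
rewrite /aff_trans /= => /eqP gh0.
have := congr1 (mulmx (aff_lin g)) gh0.
rewrite mulmx0 mulmxBr !mulmxA mulmxV ?lin_unit // !mul1mx.
by move/eqP; rewrite subr_eq0 => /eqP.
Qed.

Definition translation (b : 'cV[R]_n) : affine := @Affine (1%:M, b) (unitmx1 _ _).

Lemma homspace_transK :
  cancel homspace_trans (fun b => \pi_(homspace GLsub) (translation b)).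
Proof.
move=> x; rewrite -[RHS]reprK; apply/eqmodP; rewrite /= /lcoset_rel inE.
by rewrite /aff_trans /= /aff_lin /= /aff_trans /= invmx1 !mul1mx subrr.
Qed.

Lemma translationK :
  cancel (fun b => \pi_(homspace GLsub) (translation b)) homspace_trans.
Proof. by move=> b; rewrite homspace_transE. Qed.

Lemma homspace_trans_continuous : continuous homspace_trans.
Proof.
apply/quotient_continuous.
rewrite [X in continuous X](_ : _ = aff_trans); first exact: trans_continuous.
by apply/funext => g; exact: homspace_transE.
Qed.

Lemma homspace_translation_continuous :
  continuous (fun b => \pi_(homspace GLsub) (translation b)).
Proof.
move=> b; apply: continuous_comp; last exact: pi_continuous.
apply: affine_continuous.
  by rewrite (_ : _ \o _ = cst 1%:M) //; exact: cst_continuous.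
by rewrite (_ : _ \o _ = id) // => c; exact: cvg_id.
Qed.

End Affine.

Section Symmetric.
Context (R : realType).

Definition symv m : {vspace 'M[R]_m} := lker (linfun (@trmx R m m) - \1)%VF.

Lemma symvE m (S : 'M[R]_m) : (S \in symv m) = (S^T == S).
Proof.
by rewrite memv_ker add_lfunE opp_lfunE id_lfunE lfunE /= subr_eq0.
Qed.

Definition Sym m : vectType R := subvs_of (symv m).

Lemma Sym_tr m (S : Sym m) : (vsval S)^T = vsval S.
Proof. by apply/eqP; rewrite -symvE subvsP. Qed.

Definition Sym_pos m : set 'M[R]_m :=
  [set S | S^T = S /\ forall x : 'cV[R]_m, x != 0 -> 0 < (x^T *m S *m x) 0 0].

Lemma E_last_subproof n :
  delta_mx (rshift n (0 : 'I_1)) (rshift n (0 : 'I_1)) \in symv (n + 1).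
Proof. by rewrite symvE trmx_delta. Qed.

Definition E_last n : Sym (n + 1) := Subvs (E_last_subproof n).

Definition affine_mx n (g : affine R n) : 'M[R]_(n + 1) :=
  block_mx (aff_lin g) (aff_trans g) 0 1%:M.

Lemma sym_congr_subproof n (g : affine R n) (S : Sym (n + 1)) :
  affine_mx g *m vsval S *m (affine_mx g)^T \in symv (n + 1).
Proof. by rewrite symvE !trmx_mul trmxK Sym_tr mulmxA. Qed.

Definition sym_congr n (g : affine R n) (S : Sym (n + 1)) : Sym (n + 1) :=
  Subvs (sym_congr_subproof g S).

Lemma sym_congr_linear n (g : affine R n) : linear (sym_congr g).
Proof.
move=> a S T; apply/val_inj => /=.
by rewrite mulmxDr mulmxDl -scalemxAr -scalemxAl.
Qed.

HB.instance Definition _ n (g : affine R n) :=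
  GRing.isLinear.Build R (Sym (n + 1)) (Sym (n + 1)) _ (sym_congr g)
    (sym_congr_linear g).

Definition sym_rep n (g : affine R n) : 'End(Sym (n + 1)) :=
  linfun (sym_congr g).

Lemma sym_repE n (g : affine R n) (S : Sym (n + 1)) :
  vsval (sym_rep g S) = affine_mx g *m vsval S *m (affine_mx g)^T.
Proof. by rewrite lfunE. Qed.

End Symmetric.

Section Lebesgue.
Context (R : realType).

Lemma continuous_borel_measurable (T U : ptopologicalType) (f : T -> U) :
  continuous f -> measurable_fun setT (f : borel T -> borel U).
Proof.
move=> /continuousP cf; apply: (@measurability _ _ (borel T) (borel U) setT f (@open U)) => //.
by move=> _ [A oA <-]; rewrite setTI; apply: sub_sigma_algebra; exact: cf.
Qed.

Definition cV_cons n (xv : R * 'cV[R]_n) : 'cV[R]_n.+1 :=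
  col_mx (xv.1%:M : 'M[R]_(1, 1)) xv.2.

Definition cV_uncons n (v : 'cV[R]_n.+1) : R * 'cV[R]_n :=
  (v 0 0, dsubmx (v : 'M[R]_(1 + n, 1))).

Lemma cV_consK n : cancel (@cV_cons n) (@cV_uncons n).
Proof.
move=> [x v]; rewrite /cV_uncons /cV_cons /= col_mxKd; congr pair.
transitivity (col_mx (x%:M : 'M[R]_(1, 1)) v (lshift n 0) 0).
  by congr (col_mx _ _ _ _); apply/val_inj.
by rewrite col_mxEu mxE.
Qed.

Lemma cV_unconsK n : cancel (@cV_uncons n) (@cV_cons n).
Proof.
move=> v; apply: etrans (vsubmxK (v : 'M[R]_(1 + n, 1))).
rewrite /cV_uncons /cV_cons /=; congr col_mx; apply/matrixP => i j; rewrite !ord1 !mxE eqxx mulr1n.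
by congr (v _ _); apply/val_inj.
Qed.

Lemma cV_cons_continuous n : continuous (@cV_cons n).
Proof.
apply: mx_continuousP => i j.
case: (split_ordP (i : 'I_(1 + n))) => k -> {i}.
  rewrite (_ : (fun t => _) = fst); first by move=> t; exact: cvg_fst.
  by apply/funext => t; apply: etrans (col_mxEu _ _ _ _) _; rewrite mxE !ord1 eqxx mulr1n.
rewrite (_ : (fun t => _) = (fun t : R * 'cV[R]_n => t.2 k j)).
  move=> t; apply: (@continuous_comp _ _ _ snd (fun v : 'cV[R]_n => v k j)).
    exact: cvg_snd.
  exact: coord_continuous.
by apply/funext => t; exact: (@col_mxEd _ 1 n 1).
Qed.

Lemma cV_uncons_measurable n :
  measurable_fun setT (@cV_uncons n : borel 'cV[R]_n.+1 -> R * borel 'cV[R]_n).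
Proof.
apply/measurable_fun_pairP; split.
  apply: (measurability _ (RGenOpens.measurableE R)) => _ [_ [a [b ->] <-]].
  rewrite setTI; apply: sub_sigma_algebra.
  have /continuousP c : continuous (fun v : 'cV[R]_n.+1 => v 0 0).
    exact: coord_continuous.
  exact/c/interval_open.
apply: continuous_borel_measurable; apply: mx_continuousP => i j.
rewrite (_ : (fun t => _) = (fun t : 'cV[R]_n.+1 => t (rshift 1 i) j)).
  exact: coord_continuous.
by apply/funext => t; rewrite /= mxE.
Qed.

Lemma open_prod_measurable n (W : set (R * 'cV[R]_n)) : open W ->
  measurable (W : set (R * borel 'cV[R]_n)).
Proof.
move=> oW.
pose B (i : rat * 'cV[rat]_n * nat) : set (R * borel 'cV[R]_n) :=
  ball (ratr i.1.1 : R) i.2.+1%:R^-1 `*`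
  ball (map_mx ratr i.1.2 : 'cV[R]_n) i.2.+1%:R^-1.
rewrite (_ : W = \bigcup_i (if `[< B i `<=` W >] then B i else set0)).
  apply: countable_bigcupT_measurable => // -[[q w] k].
  case: ifPn => // _; apply: measurableX.
    by apply: open_measurable; exact: ball_open.
  by apply: sub_sigma_algebra; exact: ball_open.
apply/seteqP; split; last by move=> x [i _]; case: ifPn => // /asboolP; exact.
move=> [x v] Wxv.
have [e /= e0 eW] : exists2 e : R, 0 < e & ball (x, v) e `<=` W.
  by move: oW; rewrite openE => /(_ _ Wxv)/nbhs_ballP[e e0 eW]; exists e.
pose k := Num.truncn (2 / e).
have k0 : 0 < k.+1%:R^-1 :> R by rewrite invr_gt0.
have ke : k.+1%:R^-1 + k.+1%:R^-1 < e.
  rewrite -mulr2n -(mulr_natl _ 2) ltr_pdivrMr // mulrC -ltr_pdivrMr //.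
  exact: truncnS_gt.
have near_rat (y : R) : exists q : rat, ball (ratr q : R) k.+1%:R^-1 y.
  have /rat_in_itvoo[q] : y - k.+1%:R^-1 < y + k.+1%:R^-1 by rewrite ltrD2l gtrN.
  rewrite in_itv /= => /andP[q1 q2]; exists q; rewrite /ball /=.
  by rewrite ltr_norml ltrBrDr ltrBlDr [- _ + _]addrC q1 /= [_ + y]addrC q2.
have [q qx] := near_rat x.
pose w : 'cV[rat]_n := \col_i sval (cid (near_rat (v i 0))).
have wv : ball (map_mx ratr w : 'cV[R]_n) k.+1%:R^-1 v.
  by split=> // i j; rewrite !mxE ord1; case: cid.
exists (q, w, k) => //; rewrite ifT; last first.
  apply/asboolP => -[y u] [/= qy wu]; apply: eW; split => /=.
    by apply: le_ball (ltW ke) _ _; apply: ball_triangle qy; exact: ball_sym.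
  by apply: le_ball (ltW ke) _ _; apply: ball_triangle wu; exact: ball_sym.
by split.
Qed.

Section LebesgueStep.
Context n (mu : {sigma_finite_measure set (borel 'cV[R]_n) -> \bar R}).
Local Open Scope ereal_scope.

Lemma cV_cons_measurable :
  measurable_fun setT (@cV_cons n : R * borel 'cV[R]_n -> borel 'cV[R]_n.+1).
Proof.
apply: (@measurability _ _ _ (borel 'cV[R]_n.+1) setT _ (@open 'cV[R]_n.+1)) => //.
move=> _ [A oA <-]; rewrite setTI; apply: open_prod_measurable.
by move/continuousP: (@cV_cons_continuous n); exact.
Qed.

Definition lebesgue_step (A : set (borel 'cV[R]_n.+1)) : \bar R :=
  (lebesgue_measure \x mu) (@cV_cons n @^-1` A).

Let mcons (A : set (borel 'cV[R]_n.+1)) : measurable A ->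
  measurable (@cV_cons n @^-1` A : set (R * borel 'cV[R]_n)).
Proof. by move=> mA; rewrite -[X in measurable X]setTI; exact: cV_cons_measurable. Qed.

Let lebesgue_step0 : lebesgue_step set0 = 0.
Proof. by rewrite /lebesgue_step preimage_set0 measure0. Qed.

Let lebesgue_step_ge0 A : 0 <= lebesgue_step A.
Proof. exact: measure_ge0. Qed.

Let lebesgue_step_sigma_additive : semi_sigma_additive lebesgue_step.
Proof.
move=> F mF tF mUF; rewrite /lebesgue_step preimage_bigcup.
apply: measure_semi_sigma_additive.
- by move=> k; exact: mcons.
- apply/trivIsetP => /= i j _ _ ij; rewrite -preimage_setI.
  by move/trivIsetP : tF => /(_ _ _ _ _ ij) ->//; rewrite preimage_set0.
- by rewrite -preimage_bigcup; exact: mcons.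
Qed.

HB.instance Definition _ := isMeasure.Build _ _ _
  lebesgue_step lebesgue_step0 lebesgue_step_ge0 lebesgue_step_sigma_additive.

Let lebesgue_step_sigma_finite : sigma_finite setT lebesgue_step.
Proof.
have /sigma_finiteP[F [FT ndF Foo]] := sigma_finiteT (@lebesgue_measure R).
have /sigma_finiteP[G [GT ndG Goo]] := sigma_finiteT mu.
exists (fun k => @cV_uncons n @^-1` (F k `*` G k)).
  rewrite -preimage_bigcup (_ : \bigcup_k _ = setT) ?preimage_setT //.
  apply/seteqP; split => // -[x v] _.
  have [[i _ Fx] [j _ Gv]] : (\bigcup_k F k) x /\ (\bigcup_k G k) v.
    by rewrite -FT -GT.
  exists (maxn i j) => //; split.
  - by move: x Fx; exact/subsetPset/ndF/leq_maxl.
  - by move: v Gv; exact/subsetPset/ndG/leq_maxr.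
move=> k; have [mF Fkoo] := Foo k; have [mG Gkoo] := Goo k; split.
  rewrite -[X in measurable X]setTI; apply: cV_uncons_measurable => //.
  exact: measurableX.
rewrite /lebesgue_step -comp_preimage (_ : _ \o _ = id) ?preimage_id.
  by rewrite product_measure1E// lte_mul_pinfty// ge0_fin_numE.
by apply/funext => x /=; rewrite cV_consK.
Qed.

HB.instance Definition _ := Measure_isSigmaFinite.Build _ _ _
  lebesgue_step lebesgue_step_sigma_finite.

End LebesgueStep.

(* Lebesgue measure on R^n: the n-fold product of the Lebesgue measure of R *)
Fixpoint lebesgue_cV n : {sigma_finite_measure set (borel 'cV[R]_n) -> \bar R} :=
  match n with
  | 0 => \d_(0 : borel 'cV[R]_0)
  | n.+1 => lebesgue_step (lebesgue_cV n)
  end.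

End Lebesgue.

Section Normal.
Context (R : realType) (n : nat).

Definition normal_density (Sigma : 'M[R]_n) (mu x : 'cV[R]_n) : R :=
  (Num.sqrt ((2 * pi) ^+ n * \det Sigma))^-1 *
  expR (- 2^-1 * ((x - mu)^T *m invmx Sigma *m (x - mu)) 0 0).

Definition normal_family : set {measure set (borel 'cV[R]_n) -> \bar R} :=
  [set p | exists Sigma mu, Sym_pos Sigma /\
    forall A : set (borel 'cV[R]_n), measurable A ->
      p A = (\int[@lebesgue_cV R n]_(x in A) (normal_density Sigma mu x)%:E)%E].

End Normal.

Definition pushforward_family (R : realType) (T U : ptopologicalType) (f : T -> U)
    (P : set {measure set (borel T) -> \bar R}) :
    set {measure set (borel U) -> \bar R} :=
  [set q | exists2 p, P p & forall A : set (borel U), measurable A ->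
    q A = pushforward p (f : borel T -> borel U) A].

(* Main.v *)
(* In the coordinate b = gH of G/H = R^n, G acts by affine maps. Every character
   of G is trivial on translations, which are commutators with a homothety;
   hence W_0 = 0, and a relatively invariant measure is translation invariant,
   i.e. a multiple of Lebesgue measure dx (by Fubini, without Haar theory).
   Moreover rho(b) v_0 = w w^T with w = (b, 1), so phi(rho(b) v_0) runs over all
   polynomials b^T P b + q^T b + r of degree at most 2. The function
   f(b) = exp(-(b^T P b + q^T b + r)) is integrable exactly when P is positive
   definite: if w^T P w <= 0 with w <> 0, then f(b + t w) + f(b - t w) >= 2 f(b)
   by AM-GM, so that translates of a cube escaping to infinity keep a fixed mass.
   When P is positive definite, completing the square and integrating out the
   coordinates one by one, with Schur complements, gives the normal density with
   Sigma = (2P)^-1 and mu = - Sigma q. *)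
Require Import Defs.
From HB Require Import structures.
From mathcomp Require Import all_boot all_order all_algebra.
From mathcomp Require Import all_classical all_reals all_analysis.
From mathcomp Require Import measurable_realfun ring lra.

Set Implicit Arguments.
Unset Strict Implicit.
Unset Printing Implicit Defensive.
Import Order.TTheory GRing.Theory Num.Theory.
Import numFieldNormedType.Exports.
Local Open Scope classical_set_scope.
Local Open Scope ring_scope.

(** * Lebesgue measure on column vectors *)

Section MeasureGenerics.
Context (R : realType).

Lemma continuous_measurable_real (T : ptopologicalType) (f : T -> R) :
  continuous f -> measurable_fun setT (f : borel T -> R).
Proof.
move=> /continuousP cf.
apply: (measurability _ (RGenOpens.measurableE R)) => _ [_ [a [b ->] <-]].
rewrite setTI; apply: sub_sigma_algebra.
exact/cf/interval_open.
Qed.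

Lemma trmx_continuous m n : continuous (@trmx R m n).
Proof.
apply: mx_continuousP => i j.
rewrite (_ : (fun _ => _) = (fun v : 'M[R]_(m, n) => v j i)); first exact: coord_continuous.
by apply/funext => v; rewrite mxE.
Qed.

Lemma measurable_coord n (i : 'I_n) :
  measurable_fun setT (fun v : borel 'cV[R]_n => v i 0 : R).
Proof. exact: continuous_measurable_real (@coord_continuous _ _ _ i 0). Qed.

(** Since [cV_cons] is measurable from the product sigma-algebra, induction on [n] splits off the
    first coordinate and leaves a vector of size [n]. *)
Lemma measurable_cV d (T : measurableType d) n (f : T -> borel 'cV[R]_n) :
  (forall i, measurable_fun setT (fun t => f t i 0 : R)) ->
  measurable_fun setT f.
Proof.
elim: n f => [|n IH] f mf.
  have -> : f = cst (0 : 'cV[R]_0) by apply/funext => t; exact: flatmx0.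
  exact: measurable_cst.
have -> : f = @cV_cons R n \o (@cV_uncons R n \o f).
  by apply/funext => t /=; rewrite cV_unconsK.
apply: (measurableT_comp (@cV_cons_measurable R n)).
apply/measurable_fun_pairP; split; first exact: mf.
apply: IH => i.
rewrite (_ : (fun _ => _) = (fun t => f t (rshift 1 i) 0)); first exact: mf.
by apply/funext => t /=; rewrite mxE.
Qed.

Lemma measurable_addcV d (T : measurableType d) n (f g : T -> borel 'cV[R]_n) :
  measurable_fun setT f -> measurable_fun setT g ->
  measurable_fun setT (fun t => (f t : 'cV[R]_n) + g t : borel 'cV[R]_n).
Proof.
move=> mf mg; apply: measurable_cV => i.
rewrite (_ : (fun _ => _) = (fun t => (f t : 'cV[R]_n) i 0 + (g t : 'cV[R]_n) i 0)).
  by apply: measurable_funD; exact: (measurableT_comp (measurable_coord i)).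
by apply/funext => t; rewrite mxE.
Qed.

Lemma measurable_oppcV n :
  measurable_fun setT (fun v : borel 'cV[R]_n => - (v : 'cV[R]_n) : borel 'cV[R]_n).
Proof.
by apply: continuous_borel_measurable => v; apply: continuousN => //; exact: cvg_id.
Qed.

Lemma measurable_addcVr n (w : 'cV[R]_n) :
  measurable_fun setT (fun v : borel 'cV[R]_n => (v : 'cV[R]_n) + w : borel 'cV[R]_n).
Proof. by apply: measurable_addcV; [exact: measurable_id|exact: measurable_cst]. Qed.

End MeasureGenerics.

Section LebesgueTheory.
Context (R : realType).
Local Open Scope ereal_scope.

Lemma ge0_integral_lebesgue_cVS n (f : borel 'cV[R]_n.+1 -> \bar R) :
  measurable_fun setT f -> (forall v, 0 <= f v) ->
  \int[@lebesgue_cV R n.+1]_v f v =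
  \int[lebesgue_measure]_x \int[@lebesgue_cV R n]_u f (cV_cons (x, u)).
Proof.
move=> mf f0.
have mc := @cV_cons_measurable R n.
transitivity (\int[pushforward (lebesgue_measure \x @lebesgue_cV R n)
    (@cV_cons R n : measurableTypeR R * borel 'cV[R]_n -> borel 'cV[R]_n.+1)]_v f v).
  exact: eq_measure_integral.
rewrite ge0_integral_pushforward//.
rewrite preimage_setT fubini_tonelli1//; first exact: measurableT_comp.
by move=> ?; exact: f0.
Qed.

(** Tonelli in the other order, with the first coordinate innermost; this is the order in which a
    Gaussian is integrated out. *)
Lemma ge0_integral_lebesgue_cVS' n (f : borel 'cV[R]_n.+1 -> \bar R) :
  measurable_fun setT f -> (forall v, 0 <= f v) ->
  \int[@lebesgue_cV R n.+1]_v f v =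
  \int[@lebesgue_cV R n]_u \int[lebesgue_measure]_x f (cV_cons (x, u)).
Proof.
move=> mf f0; rewrite ge0_integral_lebesgue_cVS//.
apply: (@fubini_tonelli _ _ _ _ _ lebesgue_measure (@lebesgue_cV R n)
  (fun p : R * borel 'cV[R]_n => f (cV_cons p))) => [|p]; last exact: f0.
exact: measurableT_comp (@cV_cons_measurable R n).
Qed.

Lemma ge0_integral_lebesgue_shift (f : R -> \bar R) (w : R) :
  measurable_fun setT f -> (forall v, 0 <= f v) ->
  \int[lebesgue_measure]_x f (x + w)%R = \int[lebesgue_measure]_x f x.
Proof.
move=> mf f0.
have ms : measurable_fun setT (fun x : measurableTypeR R => (x + w)%R : measurableTypeR R).
  by apply: measurable_funD => //; exact: measurable_cst.
transitivity (\int[pushforward lebesgue_measure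
    (fun x : measurableTypeR R => (x + w)%R : measurableTypeR R)]_x f x).
  by rewrite ge0_integral_pushforward.
(* Lebesgue measure is determined by its values on half-open intervals, whose length a shift
   preserves. *)
apply: eq_measure_integral => A mA _; apply/esym.
apply: lebesgue_measure_unique => //= _ [[a b]] _ <-.
rewrite /pushforward /= (_ : _ @^-1` _ = (`](a - w)%R, (b - w)%R]%classic : set R)); last first.
  by apply/seteqP; split => x /=; rewrite !in_itv/= ltrBlDr lerBrDr.
rewrite !lebesgue_measure_itv/= !lte_fin ltrD2r.
by case: ifP => // _; rewrite -!EFinB; congr EFin; ring.
Qed.

Lemma cV_consD n (x y : R) (u v : 'cV[R]_n) :
  cV_cons ((x + y)%R, (u + v)%R) = (cV_cons (x, u) + cV_cons (y, v))%R.
Proof.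
rewrite /cV_cons /=; have -> : ((x + y)%:M : 'M[R]_(1,1))%R = (x%:M + y%:M)%R.
  by rewrite raddfD.
exact/esym/(@add_col_mx _ 1 n 1).
Qed.

(** Induction: the head of [w] shifts the outer one-dimensional integral, its tail the inner
    integral. *)
Lemma ge0_integral_lebesgue_cV_shift n (f : borel 'cV[R]_n -> \bar R) (w : 'cV[R]_n) :
  measurable_fun setT f -> (forall v, 0 <= f v) ->
  \int[@lebesgue_cV R n]_v f ((v : 'cV[R]_n) + w)%R = \int[@lebesgue_cV R n]_v f v.
Proof.
elim: n f w => [|n IH] f w mf f0.
  by apply: eq_integral => v _; congr f; by apply/matrixP => -[].
have mcf : measurable_fun setT (fun p : R * borel 'cV[R]_n => f (cV_cons p)).
  exact: measurableT_comp (@cV_cons_measurable R n).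
have mfw : measurable_fun setT (fun v : borel 'cV[R]_n.+1 => f ((v : 'cV[R]_n.+1) + w)%R).
  exact: measurableT_comp mf (measurable_addcVr w).
apply: etrans (ge0_integral_lebesgue_cVS mfw (fun v => f0 _)) _.
apply: etrans _ (esym (ge0_integral_lebesgue_cVS mf f0)).
rewrite -[in LHS](cV_unconsK w); set w0 := (cV_uncons w).1.
transitivity (\int[lebesgue_measure]_x
    \int[@lebesgue_cV R n]_u f (cV_cons ((x + w0)%R, u))).
  apply: eq_integral => x _.
  rewrite -[RHS](IH _ (cV_uncons w).2)//.
    by apply: eq_integral => u _; rewrite cV_consD -surjective_pairing.
  exact: (measurableT_comp mcf (measurable_pair1 _)).
rewrite (ge0_integral_lebesgue_shift (f := fun x => \int[@lebesgue_cV R n]_u f (cV_cons (x, u))))//.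
  exact: (@measurable_fun_fubini_tonelli_F _ _ _ _ _ (@lebesgue_cV R n) _ mcf).
by move=> x; exact: integral_ge0.
Qed.

Definition translation_invariant n (mu : set (borel 'cV[R]_n) -> \bar R) :=
  forall (w : 'cV[R]_n) (A : set (borel 'cV[R]_n)), measurable A ->
    mu ((fun v : 'cV[R]_n => v + w)%R @^-1` A) = mu A.

Lemma preimage_shift_measurable n (w : 'cV[R]_n) (A : set (borel 'cV[R]_n)) :
  measurable A -> measurable (((fun v : 'cV[R]_n => v + w)%R @^-1` A) : set (borel 'cV[R]_n)).
Proof.
by move=> mA; rewrite -[X in measurable X]setTI; exact: (measurable_addcVr w).
Qed.

Lemma lebesgue_cV_translation n : translation_invariant (@lebesgue_cV R n).
Proof.
have E B : measurable B -> @lebesgue_cV R n B = \int[@lebesgue_cV R n]_v (\1_B v)%:E.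
  by move=> mB; rewrite integral_indic// setIT.
move=> w A mA; rewrite (E A)// E; last exact: preimage_shift_measurable.
rewrite -(ge0_integral_lebesgue_cV_shift (f := EFin \o \1_A) w)// => [|v].
  exact/measurable_EFinP.
by rewrite lee_fin.
Qed.

End LebesgueTheory.

(** * Cubes as a compact exhaustion of R^n *)

Section Cubes.
Context (R : realType).

Definition cube n (r : R) : set 'cV[R]_n := [set v | forall i, `|v i 0| <= r].

Lemma cube_closed n r : closed (@cube n r).
Proof.
rewrite (_ : @cube n r = \bigcap_(i in setT) [set v | `|v i 0| <= r]).
  apply: closed_bigI => i _.
  have cf : continuous (fun v : 'cV[R]_n => `|v i 0|).
    by move=> v; exact: cvg_norm (@coord_continuous R n 1 i 0%R v).
  apply: (preimage_closed (f := fun v : 'cV[R]_n => `|v i 0|) (D := [set x | (x <= r)%R])).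
    by move=> v _; exact: cf.
  exact: closed_le.
by apply/seteqP; split => v /= h i => [_|]; exact: h.
Qed.

Lemma cube_compact n r : compact (@cube n r).
Proof.
(* Tychonoff for a product of segments is applied to row vectors and carried over by
   transposition. *)
have -> : @cube n r = trmx @` [set v : 'rV[R]_n | forall i, `[- r, r]%classic (v ord0 i)].
  apply/seteqP; split => [v /= h|_ [v h <-] i /=].
    exists v^T; last by rewrite trmxK.
    by move=> i; rewrite mxE in_itv/= -ler_norml; exact: h.
  by rewrite mxE; have := h i; rewrite /= in_itv/= -ler_norml.
apply: continuous_compact; last first.
  by apply: (@rV_compact R n (fun=> `[- r, r]%classic)) => _; exact: segment_compact.
by apply: continuous_subspaceT; exact: trmx_continuous.
Qed.

Lemma borel_closed (T : ptopologicalType) (A : set T) :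
  closed A -> measurable (A : set (borel T)).
Proof.
move=> cA; rewrite -[A]setCK; apply: measurableC.
by apply: sub_sigma_algebra; exact: closed_openC.
Qed.

Lemma cube_measurable n r : measurable (@cube n r : set (borel 'cV[R]_n)).
Proof. by apply: borel_closed; exact: cube_closed. Qed.

Lemma lebesgue_cV_cube n (r : R) : 0 <= r ->
  @lebesgue_cV R n (cube r) = ((2 * r) ^+ n)%:E.
Proof.
move=> r0; elim: n => [|n IH].
  rewrite /= diracE mem_set//.
  by case.
have -> : @lebesgue_cV R n.+1 (cube r) =
    (lebesgue_measure \x @lebesgue_cV R n)%E (`[- r, r]%classic `*` cube r).
  rewrite /= /lebesgue_step; congr (_ _); apply/seteqP; split => -[x u] /= h.
    split.
      rewrite /= in_itv /= -ler_norml.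
      by have := h 0; rewrite -[cV_cons _ 0 0]/((cV_uncons (cV_cons (x, u))).1) cV_consK.
    by move=> i /=; have := h (rshift 1 i); rewrite (@col_mxEd _ 1 n 1).
  case: h => /=; rewrite in_itv /= -ler_norml => hx hu i.
  case: (split_ordP (i : 'I_(1 + n))) => k -> {i}.
    by rewrite (@col_mxEu _ 1 n 1) !ord1 mxE eqxx mulr1n.
  by rewrite (@col_mxEd _ 1 n 1).
rewrite product_measure1E//; last exact: cube_measurable.
rewrite IH /= lebesgue_measure_itv/= lte_fin -EFinB.
(* The length formula branches on [- r < r]; the other branch is the degenerate cube [r = 0], of
   positive dimension here, hence of measure zero. *)
case: ltP => [_|rr]; last first.
  have -> : r = 0 by lra.
  by rewrite mulr0 exprS mul0r mul0e.
rewrite -EFinM exprS; congr (_ * _)%:E; ring.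
Qed.

Lemma cube_cover n : \bigcup_k (@cube n k%:R) = setT.
Proof.
apply/seteqP; split => // v _.
exists (Num.truncn (\big[Num.max/0]_i `|v i 0|)).+1 => //= i.
apply: le_trans (ltW (truncnS_gt _)).
exact: le_bigmax.
Qed.

Lemma cube_finite_sigma_finite n (mu : {measure set (borel 'cV[R]_n) -> \bar R}) :
  (forall k : nat, mu (cube k%:R) < +oo)%E -> sigma_finite setT mu.
Proof.
move=> muoo; exists (fun k => cube k%:R); first by rewrite cube_cover.
by move=> k; split => //; exact: cube_measurable.
Qed.
End Cubes.

(** * Uniqueness of translation invariant measures *)

Section WithSigmaFinite.
Context (R : realType) d (T : measurableType d) (mu : {measure set T -> \bar R}).

(** A copy of [mu] indexed by a proof of sigma-finiteness, so that the corresponding structure can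
    be attached to it and Tonelli applied. *)
Definition with_sigma_finite of sigma_finite setT mu : set T -> \bar R := mu.

Context (sf : sigma_finite setT mu).

HB.instance Definition _ := Measure.copy (with_sigma_finite sf) mu.
HB.instance Definition _ := Measure_isSigmaFinite.Build _ _ _ (with_sigma_finite sf) sf.

End WithSigmaFinite.

Section TranslationInvariant.
Context (R : realType) (n : nat).
Local Open Scope ereal_scope.

Lemma ge0_integral_translation (mu : {measure set (borel 'cV[R]_n) -> \bar R})
    (f : borel 'cV[R]_n -> \bar R) (w : 'cV[R]_n) :
  translation_invariant mu -> measurable_fun setT f -> (forall v, 0 <= f v) ->
  \int[mu]_v f ((v : 'cV[R]_n) + w)%R = \int[mu]_v f v.
Proof.
move=> tmu mf f0; have ms := measurable_addcVr w.
transitivity (\int[pushforward mu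
    (fun v : borel 'cV[R]_n => ((v : 'cV[R]_n) + w)%R : borel 'cV[R]_n)]_v f v).
  by rewrite [RHS]ge0_integral_pushforward.
by apply: eq_measure_integral => A mA _; exact: tmu.
Qed.

Lemma translation_invariant_unique (mu : {measure set (borel 'cV[R]_n) -> \bar R}) :
  translation_invariant mu -> (forall k : nat, mu (cube k%:R) < +oo) ->
  forall B : set (borel 'cV[R]_n), measurable B ->
    mu (cube 1) * @lebesgue_cV R n B = mu B * @lebesgue_cV R n (cube 1).
Proof.
(* Compute the integral of 1_K(x) 1_B(x + y) against mu(dx) dy in both orders,
   for the symmetric set K = cube 1. *)
move=> tmu muoo B mB.
pose sf := cube_finite_sigma_finite muoo.
pose M : {sigma_finite_measure set (borel 'cV[R]_n) -> \bar R} := with_sigma_finite sf.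
pose L := @lebesgue_cV R n.
have tL : translation_invariant L := @lebesgue_cV_translation R n.
set K : set (borel 'cV[R]_n) := cube 1.
have mK : measurable K by exact: cube_measurable.
(* The symmetry of [K] turns [x - y] into [y - x], a translate of the integration variable [y]. *)
have Kopp (x y : 'cV[R]_n) : (\1_K (x - y) = \1_K (y - x) :> R)%R.
  rewrite !indicE; congr (_%:R); congr nat_of_bool; apply/idP/idP; rewrite !inE => h i.
    by rewrite -opprB mxE normrN; exact: h.
  by rewrite -opprB mxE normrN; exact: h.
have ind_int (m : {measure set (borel 'cV[R]_n) -> \bar R}) A : measurable A ->
    \int[m]_v (\1_A v)%:E = m A by move=> mA; rewrite integral_indic// setIT.
have ind0 A (x : borel 'cV[R]_n) : 0 <= (\1_A x : R)%:E by rewrite lee_fin.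
have mind A : measurable A -> measurable_fun setT (fun x : borel 'cV[R]_n => (\1_A x : R)%:E).
  by move=> mA; exact/measurable_EFinP.
have mfst : measurable_fun setT (fst : borel 'cV[R]_n * borel 'cV[R]_n -> borel 'cV[R]_n).
  exact: measurable_fst.
have msnd : measurable_fun setT (snd : borel 'cV[R]_n * borel 'cV[R]_n -> borel 'cV[R]_n).
  exact: measurable_snd.
(* With [y] innermost, invariance of [L] makes the inner integral of the second factor [L B] for
   every [x]. *)
transitivity (\int[M]_x \int[L]_y ((\1_K x)%:E * (\1_B ((x : 'cV[R]_n) + y)%R)%:E)).
  transitivity (\int[M]_x ((\1_K x)%:E * L B)).
    by rewrite ge0_integralZr//= ?ind_int//; exact: mind.
  apply: eq_integral => x _; rewrite ge0_integralZl//; last first.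
    by apply: measurableT_comp (mind _ mB) _; apply: measurable_addcV.
  congr (_ * _); apply: etrans (esym (ind_int L B mB)) _.
  apply: etrans (esym (ge0_integral_translation x tL (mind _ mB) (ind0 B))) _.
  by apply: eq_integral => y _; rewrite addrC.
rewrite (@fubini_tonelli _ _ _ _ _ M L (fun p => (\1_K p.1)%:E * (\1_B ((p.1 : 'cV[R]_n) + p.2)%R)%:E))//=.
  (* With [x] innermost, invariance of [mu] allows replacing [x] by [x - y]. Swapping back, the
     [y]-integral of the first factor is [L K] for every [x]. *)
  transitivity (\int[L]_y \int[M]_x ((\1_K ((x : 'cV[R]_n) - y)%R)%:E * (\1_B x)%:E)).
    apply: eq_integral => y _.
    rewrite -[RHS](ge0_integral_translation (mu := M) y tmu)//=.
    - by apply: eq_integral => x _; rewrite addrK.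
    - apply: emeasurable_funM; last exact: mind.
      by apply: measurableT_comp (mind _ mK) _; apply: measurable_addcV.
  rewrite -(@fubini_tonelli _ _ _ _ _ M L (fun p => (\1_K ((p.1 : 'cV[R]_n) - p.2)%R)%:E * (\1_B p.1)%:E))//=.
  - transitivity (\int[M]_x (L K * (\1_B x)%:E)); last first.
      by rewrite ge0_integralZl//= ?ind_int// 1?muleC//; exact: mind.
    apply: eq_integral => x _; rewrite ge0_integralZr//; last first.
      apply: measurableT_comp (mind _ mK) _; apply: measurable_addcV => //.
      exact: measurable_oppcV.
    congr (_ * _); apply: etrans _ (ind_int L K mK).
    apply: etrans _ (ge0_integral_translation (- x)%R tL (mind _ mK) (ind0 K)).
    by apply: eq_integral => y _; rewrite Kopp.
  - apply: emeasurable_funM; last exact: measurableT_comp (mind _ mB) mfst.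
    apply: measurableT_comp (mind _ mK) _; apply: measurable_addcV => //.
    exact: measurableT_comp (@measurable_oppcV R n) msnd.
- apply: emeasurable_funM; first exact: measurableT_comp (mind _ mK) mfst.
  by apply: measurableT_comp (mind _ mB) _; exact: measurable_addcV.
Qed.

(** Divide the previous identity by the Lebesgue measure 2^n of the unit cube. The constant
    [mu (cube 1) / 2 ^+ n] may be zero at this stage. *)
Lemma translation_invariantE (mu : {measure set (borel 'cV[R]_n) -> \bar R}) :
  translation_invariant mu -> (forall k : nat, mu (cube k%:R) < +oo) ->
  exists c : {nonneg R}, forall B : set (borel 'cV[R]_n), measurable B ->
    mu B = c%:num%:E * @lebesgue_cV R n B.
Proof.
move=> tmu muoo; have U := translation_invariant_unique tmu muoo.
have K2 : @lebesgue_cV R n (cube 1) = (2 ^+ n)%:E by rewrite lebesgue_cV_cube ?mulr1.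
have p2 : (0 < 2 ^+ n :> R)%R by rewrite exprn_gt0.
have fK : mu (cube 1) \is a fin_num by rewrite ge0_fin_numE//; exact: (muoo 1%N).
have c0 : (0 <= fine (mu (cube 1)) / 2 ^+ n)%R by rewrite divr_ge0 ?fine_ge0// ltW.
exists (NngNum c0) => B mB /=.
have := U B mB; rewrite K2 -[mu (cube 1)]fineK// => /(congr1 (fun x => x * (2 ^+ n)^-1%:E)).
by rewrite -[in RHS]muleA -EFinM mulfV ?gt_eqF// mule1 => <-; rewrite muleAC EFinM.
Qed.

End TranslationInvariant.

(** * Gaussian integrals *)

Section Gaussian.
Context (R : realType).

Definition quad n (P : 'M[R]_n) (x : 'cV[R]_n) : R := (x^T *m P *m x) 0 0.

Lemma quad_continuous n (P : 'M[R]_n) : continuous (quad P).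
Proof.
have c : continuous (fun x : 'cV[R]_n => x^T *m P *m x).
  have cid : continuous (fun x : 'cV[R]_n => x) by move=> x; exact: cvg_id.
  have ccst : continuous (fun _ : 'cV[R]_n => P) by exact: cst_continuous.
  exact: (mulmx_continuous (mulmx_continuous (@trmx_continuous R n 1) ccst) cid).
move=> x.
exact: (@continuous_comp _ _ _ _ (fun M : 'M[R]_1 => M 0 0) x (c x) (@coord_continuous R 1 1 0 0 _)).
Qed.

Lemma measurable_expR_quad n (P : 'M[R]_n) (k : R) :
  measurable_fun setT (fun x : borel 'cV[R]_n => (expR (k * quad P x))%:E).
Proof.
apply/measurable_EFinP; apply: measurableT_comp => //.
apply: measurable_funM; first exact: measurable_cst.
exact: continuous_measurable_real (@quad_continuous _ P).
Qed.

(** The normal density with mean [- m] and variance [a^-1] has total mass one, and its peak value is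
    the inverse of the right-hand side. *)
Lemma integral_gauss1 (a m : R) : 0 < a ->
  (\int[lebesgue_measure]_x (expR (- 2^-1 * (a * (x + m) ^+ 2)))%:E =
   (Num.sqrt (2 * pi / a))%:E)%E.
Proof.
move=> a0; set s := Num.sqrt a^-1.
have ai : 0 < a^-1 by rewrite invr_gt0.
have s0 : s != 0 by rewrite gt_eqF// sqrtr_gt0.
have s2 : s ^+ 2 = a^-1 by rewrite sqr_sqrtr// ltW.
have := integral_normal_pdf (- m) s; rewrite (normal_pdfE _ s0).
under eq_integral do rewrite EFinM.
rewrite ge0_integralZl//=; first last.
- by rewrite lee_fin normal_peak_ge0.
- by move=> x _; rewrite lee_fin expR_ge0.
- by apply/measurable_EFinP; exact: measurable_normal_fun.
have pE : normal_peak s = (Num.sqrt (2 * pi / a))^-1.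
  by rewrite /normal_peak s2; congr (Num.sqrt _)^-1; rewrite -mulr_natr; ring.
have p0 : 0 < Num.sqrt (2 * pi / a).
  by rewrite sqrtr_gt0 divr_gt0// mulr_gt0// pi_gt0.
rewrite pE.
have -> : (\int[lebesgue_measure]_x (normal_fun (- m) s x)%:E =
   \int[lebesgue_measure]_x (expR (- 2^-1 * (a * (x + m) ^+ 2)))%:E)%E.
  apply: eq_integral => x _; congr (expR _)%:E.
  by rewrite s2 opprK -mulr_natr; field; rewrite gt_eqF.
move=> /(congr1 (fun y => (Num.sqrt (2 * pi / a))%:E * y)%E).
by rewrite muleA -EFinM mulfV ?gt_eqF// mul1e mule1.
Qed.

Section Schur.
Context (n : nat) (P : 'M[R]_(1 + n)).
Hypothesis sP : P^T = P.
Let a := P 0 0.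
Let b : 'cV[R]_n := dlsubmx P.
(** The Schur complement of the entry [a]: the form that remains after completing the square in the
    first coordinate. *)
Definition schur : 'M[R]_n := drsubmx P - a^-1 *: (b *m b^T).
Hypothesis a0 : a != 0.

Let PE : P = block_mx (a%:M : 'M[R]_1) (b^T) b (drsubmx P).
Proof.
rewrite -[LHS]submxK; congr block_mx.
  apply/matrixP => i j; rewrite !ord1 !mxE eqxx mulr1n; congr (P _ _); exact/val_inj.
by rewrite /b trmx_dlsub sP.
Qed.

Lemma tr_schur : schur^T = schur.
Proof.
rewrite /schur linearB /= linearZ /= trmx_mul trmxK; congr (_ - _).
by rewrite trmx_drsub sP.
Qed.

Lemma det_schur : \det P = a * \det schur.
Proof.
(* Block elimination: a unitriangular factor times a block upper triangular one with diagonal blocks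
   [a] and [schur]. *)
rewrite {1}PE (_ : block_mx _ _ _ _ =
    block_mx (1%:M : 'M[R]_1) 0 (a^-1 *: b) 1%:M *m block_mx (a%:M : 'M[R]_1) (b^T) 0 schur).
  by rewrite det_mulmx det_lblock det_ublock !det1 !mul1r det_scalar expr1.
rewrite mulmx_block !mul1mx !mul0mx ?mulmx0 !addr0; congr block_mx.
  by rewrite mul_mx_scalar scalerA mulfV// scale1r.
by rewrite /schur -scalemxAl addrC subrK.
Qed.

Lemma quad_schur (t : R) (u : 'cV[R]_n) :
  quad P (cV_cons (t, u)) = a * (t + a^-1 * (b^T *m u) 0 0) ^+ 2 + quad schur u.
Proof.
rewrite /quad {1}PE /cV_cons /=.
rewrite (@tr_col_mx _ 1 n 1) tr_scalar_mx.
rewrite (@mul_row_block _ 1 1 n 1 n) (@mul_row_col _ 1 1 n 1).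
set y := (b^T *m u) 0 0.
have ub : u^T *m b = y%:M.
  by rewrite [LHS]mx11_scalar /y -[in LHS](trmxK (u^T *m b)) trmx_mul trmxK mxE.
have bu : b^T *m u = y%:M by rewrite [LHS]mx11_scalar.
rewrite ub !mul_scalar_mx [in X in _ = _ + X]/schur mulmxBr mulmxBl.
rewrite -scalemxAr -scalemxAl (mulmxA _ b) ub mul_scalar_mx -[in RHS]scalemxAl bu.
rewrite mul_mx_scalar mulmxDl -[in LHS]scalemxAl bu !mxE eqxx !mulr1n.
set z := \sum__ _.
by field.
Qed.
End Schur.

Lemma quad_delta n (P : 'M[R]_n) (i : 'I_n) : quad P (delta_mx i 0) = P i i.
Proof. by rewrite /quad trmx_delta -rowE -colE !mxE. Qed.

Lemma Sym_pos_diag n (P : 'M[R]_n) (i : 'I_n) : Sym_pos P -> 0 < P i i.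
Proof.
move=> [_ pP]; rewrite -quad_delta; apply: pP.
apply/eqP => /matrixP/(_ i 0); rewrite !mxE !eqxx => /eqP.
by rewrite oner_eq0.
Qed.

Lemma Sym_pos_schur n (P : 'M[R]_(1 + n)) : Sym_pos P -> Sym_pos (schur P).
Proof.
move=> pP; have [sP pP'] := pP; have a0 := Sym_pos_diag 0 pP.
split; first exact: tr_schur.
move=> u u0; rewrite -/(quad _ _).
(* This first coordinate makes the square in [quad_schur] vanish, so [P] at [(t, u)] takes the value
   of [schur P] at [u]. *)
pose t := - ((P 0 0)^-1 * ((dlsubmx P)^T *m u) 0 0).
have := pP' (cV_cons (t, u)); rewrite -/(quad _ _) (quad_schur sP) ?gt_eqF//.
rewrite addNr expr0n/= mulr0 add0r; apply.
apply: contraNneq u0 => /(congr1 (@cV_uncons R n)); rewrite cV_consK => -[_ ->].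
by rewrite /cV_uncons linear0.
Qed.

Lemma Sym_pos_det n (P : 'M[R]_n) : Sym_pos P -> 0 < \det P.
Proof.
elim: n P => [|n IH] P pP; first by rewrite det_mx00.
have a0 : 0 < P 0 0 := Sym_pos_diag 0 pP.
rewrite (@det_schur n) ?gt_eqF//; last by case: pP.
by rewrite mulr_gt0//; exact/IH/(@Sym_pos_schur n).
Qed.

Lemma integral_gauss n (P : 'M[R]_n) : Sym_pos P ->
  (\int[@lebesgue_cV R n]_x (expR (- 2^-1 * quad P x))%:E =
   (Num.sqrt ((2 * pi) ^+ n / \det P))%:E)%E.
Proof.
elim: n P => [|n IH] P pP.
  (* In dimension zero the measure is a Dirac mass, the form is zero and the empty determinant is
     one. *)
  rewrite /= integral_dirac//; last exact: measurable_expR_quad.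
  rewrite diracT mul1e /quad mulmx0 mxE mulr0 expR0 det_mx00 expr0 divr1 sqrtr1//.
have a0 : 0 < P 0 0 := Sym_pos_diag 0 pP.
have sP : P^T = P by case: pP.
have pS := @Sym_pos_schur n P pP.
rewrite ge0_integral_lebesgue_cVS'//; last exact: (measurable_expR_quad P (- 2^-1)).
(* For fixed [u] the first coordinate contributes a one-dimensional Gaussian. Only its centre
   depends on [u], so its integral is a constant. *)
transitivity (\int[@lebesgue_cV R n]_u ((Num.sqrt (2 * pi / P 0%R 0%R))%:E *
    (expR (- 2^-1 * quad (@schur n P) u))%:E))%E.
  apply: eq_integral => u _.
  under eq_integral do rewrite (@quad_schur n P sP) ?gt_eqF// mulrDr expRD EFinM.
  rewrite ge0_integralZr//= ?lee_fin ?expR_ge0//; last first.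
    apply/measurable_EFinP; apply: measurableT_comp => //.
    apply: measurable_funM; first exact: measurable_cst.
    apply: measurable_funM; first exact: measurable_cst.
    by apply: measurable_funX; apply: measurable_funD => //; exact: measurable_cst.
  by rewrite integral_gauss1.
rewrite ge0_integralZl//= ?lee_fin ?sqrtr_ge0//; last first.
  exact: (measurable_expR_quad _ (- 2^-1)).
rewrite IH// -EFinM -sqrtrM; last first.
  by rewrite divr_ge0 ?mulr_ge0 ?pi_ge0 ?ltW.
congr (Num.sqrt _)%:E; rewrite (@det_schur n P)// ?gt_eqF//.
have d0 := Sym_pos_det pS.
by rewrite exprS; field; rewrite !gt_eqF.
Qed.
End Gaussian.

(** * Integrability of exponentials of quadratic polynomials *)

Section Escape.
Context (R : realType) (n : nat).
Variables (f : borel 'cV[R]_n -> R) (w : 'cV[R]_n).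
Hypothesis mf : measurable_fun setT f.
Hypothesis f0 : forall x, 0 < f x.
Hypothesis w0 : w != 0.
Hypothesis f_mid : forall (b : 'cV[R]_n) (t : R), f b + f b <= f (b + t *: w) + f (b - t *: w).
Let L := @lebesgue_cV R n.

Let f_ge0 x : 0 <= f x. Proof. exact/ltW. Qed.

Let mindf (A : set (borel 'cV[R]_n)) (g : borel 'cV[R]_n -> R) : measurable A ->
  measurable_fun setT g -> measurable_fun setT (fun x => (\1_A x * g x)%:E).
Proof. by move=> mA mg; apply/measurable_EFinP; exact: measurable_funM. Qed.

(* The two translates [cube 1 +- t w] together carry at least twice the mass of
   [cube 1] but escape to infinity with [t]. *)
Lemma midpoint_superharmonic_integral : (\int[L]_x (f x)%:E = +oo)%E.
Proof.
apply/eqP; rewrite eq_le leey leNgt/=; apply/negP => foo.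
(* The escape to infinity is measured along a coordinate in which [w] does not vanish. *)
have [i wi] : exists i, w i 0 != 0.
  apply: contrapT => /forallNP h; move/eqP: w0; apply; apply/matrixP => i j.
  by rewrite ord1 mxE; apply/eqP/negPn/negP => /h.
pose K : set (borel 'cV[R]_n) := cube 1.
have mK : measurable K by exact: cube_measurable.
pose S (k : nat) : set (borel 'cV[R]_n) := [set b | k%:R <= `|b i 0|].
have mS k : measurable (S k).
  have mi : measurable_fun setT (fun b : borel 'cV[R]_n => `|b i 0|).
    by apply: measurableT_comp => //; exact: measurable_coord.
  rewrite (_ : S k = setT `&` (fun b : borel 'cV[R]_n => `|b i 0|) @^-1` `[k%:R, +oo[%classic).
    exact: mi.
  by apply/seteqP; split => x /=; rewrite in_itv/= andbT => // -[].
pose I k : \bar R := (\int[L]_x (\1_(S k) x * f x)%:E)%E.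
pose m : \bar R := (\int[L]_x (\1_K x * f x)%:E)%E.
have step k : (m + m <= I k + I k)%E.
  (* A shift by [t *: w] moves coordinate [i] by [k + 1]; the cube has half-width 1, so its
     translate lies in [S k]. *)
  pose t := k.+1%:R / `|w i 0|.
  have shift_le s : `|s| = t -> (\int[L]_x (\1_K x * f ((x : 'cV[R]_n) + s *: w))%:E <= I k)%E.
    move=> st.
    rewrite [leLHS](_ : _ = \int[L]_x (\1_K ((x : 'cV[R]_n) - s *: w) * f x)%:E)%E; last first.
      rewrite -[RHS](ge0_integral_translation (s *: w) (@lebesgue_cV_translation R n))//.
      - by apply: eq_integral => x _; rewrite addrK.
      - apply/measurable_EFinP; apply: measurable_funM => //.
        exact: measurableT_comp (measurable_addcVr (- (s *: w))).
      - by move=> v; rewrite lee_fin mulr_ge0.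
    apply: ge0_le_integral => //.
    - by move=> x _; rewrite lee_fin mulr_ge0.
    - apply/measurable_EFinP; apply: measurable_funM => //.
      exact: measurableT_comp (measurable_addcVr (- (s *: w))).
    - exact: mindf.
    move=> x _; rewrite lee_fin ler_wpM2r// !indicE.
    have [|_] := boolP (_ \in K); last by rewrite ler0n.
    rewrite inE => /(_ i); rewrite !mxE => Kx.
    rewrite mem_set//= /S/=.
    have sw : `|s * w i 0| = k.+1%:R by rewrite normrM st divfK// normr_eq0.
    have := ler_normB (x i 0) (x i 0 - s * w i 0).
    rewrite opprB addrC subrK sw -natr1 => h.
    by rewrite -(lerD2r 1); apply: le_trans h _; rewrite lerD2l.
  have -> : (m + m = \int[L]_x (\1_K x * (f x + f x))%:E)%E.
    rewrite /m -ge0_integralD//.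
    - by apply: eq_integral => x _; rewrite mulrDr EFinD.
    - by move=> x _; rewrite lee_fin mulr_ge0.
    - exact: mindf.
    - by move=> x _; rewrite lee_fin mulr_ge0.
    - exact: mindf.
  have st1 : `|t| = t by rewrite ger0_norm// divr_ge0.
  have st2 : `|- t| = t by rewrite normrN.
  apply: le_trans (leeD (shift_le t st1) (shift_le (- t) st2)).
  rewrite /m -ge0_integralD//.
  - apply: ge0_le_integral => //.
    + by move=> x _; rewrite lee_fin mulr_ge0 ?addr_ge0.
    + by apply: mindf => //; exact: measurable_funD.
    + apply: emeasurable_funD; apply: mindf => //.
        exact: measurableT_comp (measurable_addcVr (t *: w)).
      exact: measurableT_comp (measurable_addcVr (- t *: w)).
    + move=> x _; rewrite -EFinD lee_fin -mulrDr ler_wpM2l// scaleNr.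
      exact: f_mid.
  - by move=> x _; rewrite lee_fin mulr_ge0.
  - by apply: mindf => //; exact: measurableT_comp (measurable_addcVr (t *: w)).
  - by move=> x _; rewrite lee_fin mulr_ge0.
  - by apply: mindf => //; exact: measurableT_comp (measurable_addcVr (- t *: w)).
(* Dominated convergence: [f] is integrable by assumption and each point leaves [S k] eventually. *)
have Icvg : I @ \oo --> 0%E.
  have fi : L.-integrable setT (fun x => (f x)%:E).
    apply/integrableP; split; first exact/measurable_EFinP.
    by under eq_integral do rewrite gee0_abs ?lee_fin//.
  have := @dominated_cvg _ _ _ L setT measurableT (fun k x => (\1_(S k) x * f x)%:E)
    (cst 0%E) (fun x => (f x)%:E).
  rewrite integral0; apply => //.
  - by move=> k; exact: mindf.
  - move=> x _; apply: cvg_near_cst.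
    near=> k; rewrite indicE memNset ?mul0r// /S/=.
    apply/negP; rewrite -ltNge; near: k; exact: nbhs_infty_gtr.
  - move=> k x _; rewrite gee0_abs lee_fin ?mulr_ge0//.
    by apply: ler_piMl => //; rewrite indicE lern1 leq_b1.
have m0 : (0 <= m)%E by apply: integral_ge0 => x _; rewrite lee_fin mulr_ge0.
have : m = 0%E.
  apply/eqP; rewrite eq_le m0 andbT.
  have mI k : (m <= I k)%E.
    rewrite leNgt; apply/negP => Im; have := step k; rewrite leNgt => /negP; apply.
    by apply: lteD.
  rewrite -(cvg_lim _ Icvg)//; apply: lime_ge; first by apply/cvg_ex; exists 0%E.
  exact: nearW.
rewrite (_ : m = \int[L]_(x in setT) `|(\1_K x * f x)%:E|)%E; last first.
  by apply: eq_integral => x _; rewrite gee0_abs// lee_fin mulr_ge0.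
move=> /ae_eq_integral_abs -/(_ measurableT (mindf mK mf)) h.
(* A zero integral makes [f] vanish almost everywhere on [K]; as [f] is positive, [K] itself is
   null, against its measure 2^n. *)
have : L K = 0%E.
  apply/eqP; rewrite eq_le measure_ge0 andbT.
  case: h => B [mB B0 sB]; rewrite -B0 le_measure ?inE// => x Kx.
  apply: sB => /= /(_ Logic.I) -[]; rewrite indicE mem_set// mul1r => fx0.
  by have := f0 x; rewrite fx0 ltxx.
rewrite lebesgue_cV_cube// mulr1 => /eqP; rewrite eqe expf_eq0 pnatr_eq0 andbF//.
Unshelve. all: by end_near. Qed.
End Escape.

Section QuadraticExponent.
Context (R : realType) (n : nat).

Definition qexp (P : 'M[R]_n) (q : 'cV[R]_n) (r : R) (x : 'cV[R]_n) : R :=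
  expR (- (quad P x + (q^T *m x) 0 0 + r)).

Lemma quadD (P : 'M[R]_n) (x y : 'cV[R]_n) : P^T = P ->
  quad P (x + y) = quad P x + 2 * (x^T *m P *m y) 0 0 + quad P y.
Proof.
move=> sP; have tD : (x + y)^T = x^T + y^T by rewrite linearD.
rewrite /quad tD !mulmxDl !mulmxDr !mxE.
have -> : \sum_j (y^T *m P) 0 j * x j 0 = \sum_j (x^T *m P) 0 j * y j 0.
  have E : (y^T *m P *m x)^T = x^T *m P *m y by rewrite !trmx_mul trmxK sP mulmxA.
  by have := congr1 (fun M : 'M[R]_1 => M 0 0) E; rewrite !mxE.
by ring.
Qed.

Lemma quadZ (P : 'M[R]_n) (k : R) (x : 'cV[R]_n) : quad P (k *: x) = k ^+ 2 * quad P x.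
Proof.
have tZ : (k *: x)^T = k *: x^T by rewrite linearZ.
rewrite /quad tZ -scalemxAl -scalemxAl -scalemxAr.
by rewrite [LHS]mxE [X in _ * X]mxE mulrA.
Qed.

Lemma continuous_mulmxl m (A : 'M[R]_(m, n)) : continuous (fun x : 'cV[R]_n => A *m x).
Proof.
have cid : continuous (fun x : 'cV[R]_n => x) by move=> x; exact: cvg_id.
have ccst : continuous (fun _ : 'cV[R]_n => A) by exact: cst_continuous.
exact: (mulmx_continuous ccst cid).
Qed.

Lemma measurable_qexp P q r : measurable_fun setT (qexp P q r : borel 'cV[R]_n -> R).
Proof.
apply: measurableT_comp => //; apply: measurable_funN.
apply: measurable_funD; last exact: measurable_cst.
apply: measurable_funD; first exact: continuous_measurable_real (@quad_continuous _ _ P).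
apply: continuous_measurable_real => x.
exact: (@continuous_comp _ _ _ _ (fun M : 'M[R]_1 => M 0 0) x
  (@continuous_mulmxl 1 q^T x) (@coord_continuous R 1 1 0 0 _)).
Qed.

Lemma integrable_qexp_Sym_pos P q r : P^T = P ->
  (\int[@lebesgue_cV R n]_x (qexp P q r x)%:E < +oo)%E -> Sym_pos P.
Proof.
move=> sP foo; split => // w w0; rewrite ltNge; apply/negP; rewrite -/(quad P w) => Pw.
suff : (\int[@lebesgue_cV R n]_x (qexp P q r x)%:E = +oo)%E by move=> E; rewrite E in foo.
apply: (midpoint_superharmonic_integral (w := w)) => //.
- exact: measurable_qexp.
- by move=> x; exact: expR_gt0.
move=> b t.
pose g y := quad P y + (q^T *m y) 0 0 + r.
(* The linear and the cross terms in [t] cancel between the two points; only the second-order term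
   survives. *)
have gE : g (b + t *: w) + g (b - t *: w) = 2 * g b + 2 * (t ^+ 2 * quad P w).
  rewrite /g -scaleNr !quadD// !quadZ -!scalemxAr !mulmxDr -!scalemxAr.
  have H (u v : 'M[R]_1) : (u + v) 0 0 = u 0 0 + v 0 0 by rewrite mxE.
  have H' k (v : 'M[R]_1) : (k *: v) 0 0 = k * v 0 0 by rewrite mxE.
  by rewrite !H !H'; ring.
rewrite /qexp -/(g _) -/(g _) -/(g _).
(* AM-GM, from the square of the difference of the half exponentials. *)
have amgm (x y : R) : expR ((x + y) / 2) + expR ((x + y) / 2) <= expR x + expR y.
  have := sqr_ge0 (expR (x / 2) - expR (y / 2)).
  rewrite sqrrB -!expRM_natl -expRD.
  have -> : 2%:R * (x / 2) = x by field.
  have -> : 2%:R * (y / 2) = y by field.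
  by rewrite -mulrDl; lra.
apply: le_trans _ (amgm _ _).
have -> : (- g (b + t *: w) - g (b - t *: w)) / 2 = - g b - t ^+ 2 * quad P w.
  by rewrite -opprD gE; field.
have h : expR (- g b) <= expR (- g b - t ^+ 2 * quad P w).
  rewrite ler_expR lerDl oppr_ge0; rewrite mulr_ge0_le0 ?sqr_ge0//.
exact: lerD.
Qed.
End QuadraticExponent.

(** * Regularity of locally finite Borel measures *)

Section Regularity.
Context (R : realType) (n : nat).
Local Notation X := (borel 'cV[R]_n).

Lemma normr_cV_le (v : 'cV[R]_n) (i : 'I_n) : `|v i 0| <= `|v|.
Proof.
rewrite [leRHS]/Num.norm /= mx_normrE.
exact: (@le_bigmax _ _ _ 0 (fun ij : 'I_n * 'I_1 => `|v ij.1 ij.2|) (i, 0)).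
Qed.

Lemma compact_sub_cube (K : set 'cV[R]_n) : compact K -> exists k : nat, K `<=` cube k%:R.
Proof.
move=> /compact_bounded[M [_ KM]].
exists (Num.truncn (M + 1)).+1 => v Kv i.
apply: le_trans (normr_cV_le v i) _.
have {}KM := KM (M + 1) (ltr_pwDr ltr01 (lexx M)).
apply: le_trans (KM v Kv) _.
exact/ltW/truncnS_gt.
Qed.

(** Exhaust [U] by its points in a large cube that keep distance at least [k.+1%:R^-1] from the
    complement. *)
Lemma open_sigma_compact (U : set 'cV[R]_n) : open U ->
  exists K : nat -> set 'cV[R]_n,
    [/\ forall k, compact (K k), nondecreasing_seq K & \bigcup_k K k = U].
Proof.
move=> oU.
pose D k := [set x : 'cV[R]_n | forall y, ~ U y -> k.+1%:R^-1 <= `|x - y|].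
have cD k : closed (D k).
  rewrite (_ : D k = \bigcap_(y in ~` U) [set x | k.+1%:R^-1 <= `|x - y|]) //.
  apply: closed_bigI => y _.
  have cf : continuous (fun x : 'cV[R]_n => `|x - y|).
    move=> x; apply: (@cvg_norm _ _ _ (nbhs x)).
    exact: (@cvgB R 'cV[R]_n _ (nbhs x) _ (fun x => x) (fun=> y) x y (@cvg_id _ (nbhs x)) (cvg_cst y)).
  apply: (preimage_closed (f := fun x : 'cV[R]_n => `|x - y|) (D := [set r | k.+1%:R^-1 <= r])).
    by move=> v _; exact: cf.
  exact: closed_ge.
exists (fun k => cube k%:R `&` D k); split.
- move=> k; apply: (subclosed_compact _ (@cube_compact R n k%:R)); last exact: subIsetl.
  by apply: closedI; [exact: cube_closed|exact: cD].
- move=> k l kl; apply/subsetPset => x [cx Dx]; split.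
    by move=> i; apply: le_trans (cx i) _; rewrite ler_nat.
  move=> y Uy; apply: le_trans (Dx y Uy).
  by rewrite lef_pV2 ?posrE// ler_nat ltnS.
apply/seteqP; split=> [x [k _ [_ Dx]]|x Ux].
  apply: contrapT => /Dx; rewrite subrr normr0.
  by apply/negP; rewrite -ltNge invr_gt0.
have [e /= e0 eU] : exists2 e : R, 0 < e & ball x e `<=` U.
  by move: oU; rewrite openE => /(_ _ Ux)/nbhs_ballP[e e0 eU]; exists e.
have [i xi] : exists i, cube i%:R x.
  have : (\bigcup_k (@cube R n k%:R)) x by rewrite cube_cover.
  by move=> [i _ xi]; exists i.
(* Large enough for the cube to contain [x], and for [k.+1%:R^-1] to be at most the radius [e] of a
   ball around [x] inside [U]. *)
pose k := maxn i (Num.truncn e^-1).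
exists k => //; split.
  by move=> j; apply: le_trans (xi j) _; rewrite ler_nat leq_maxl.
move=> y Uy; rewrite leNgt; apply/negP => xy; apply/Uy/eU.
rewrite mx_norm_ball /ball_/=; apply: lt_le_trans xy _.
rewrite -[leRHS]invrK lef_pV2 ?posrE ?invr_gt0//.
apply: le_trans (ltW (truncnS_gt _)) _.
by rewrite ler_nat ltnS leq_maxr.
Qed.

(** Continuity from below along the compact exhaustion, which holds without any finiteness of
    [mu]. *)
Lemma inner_regular_open (mu : {measure set X -> \bar R}) (U : set 'cV[R]_n) : open U ->
  mu U = ereal_sup [set mu K | K in [set K : set 'cV[R]_n | compact K /\ K `<=` U]].
Proof.
move=> oU; have [K [cK ndK KU]] := open_sigma_compact oU.
have mK k : measurable (K k : set X).
  by apply: borel_closed; apply: compact_closed => //; exact: norm_hausdorff.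
have mU : measurable (U : set X) by exact: sub_sigma_algebra.
apply/eqP; rewrite eq_le; apply/andP; split; last first.
  apply: ge_ereal_sup => _ [L [cL LU] <-]; apply: le_measure; rewrite ?inE//.
  by apply: borel_closed; apply: compact_closed => //; exact: norm_hausdorff.
have : mu (K k) @[k --> \oo] --> mu U.
  by rewrite -KU; apply: nondecreasing_cvg_mu => //; rewrite KU.
move=> /[dup] Kc /cvg_lim <-//.
apply: lime_le; first by apply/cvg_ex; exists (mu U).
apply: nearW => k; apply: ereal_sup_ubound; exists (K k) => //; split => //.
by rewrite -KU; exact: bigcup_sup.
Qed.

Section FiniteMeasure.
Variable m : {finite_measure set X -> \bar R}.

(** The sets enclosed between a closed and an open set up to small mass form a sigma-algebra
    containing the open sets. Asking for both sides at once makes stability under complement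
    immediate. *)
Let approx (A : set X) := forall e : R, 0 < e -> exists F U : set 'cV[R]_n,
  [/\ closed F, open U, F `<=` A, A `<=` U & (m (U `\` F) <= e%:E)%E].

Let m_fin (A : set X) : measurable A -> (m A < +oo)%E.
Proof. by move=> mA; rewrite -ge0_fin_numE//; exact: fin_num_measure. Qed.

(** Continuity from above, which uses that [m] is finite; the strict inequality leaves room to stop
    at a finite index. *)
Let small_tail (F : nat -> set X) (e e' : R) : (forall k, measurable (F k)) ->
  nonincreasing_seq F -> (m (\bigcap_k F k) <= e%:E)%E -> e < e' ->
  exists k, (m (F k) <= e'%:E)%E.
Proof.
move=> mF niF Fe ee'; apply: contrapT => /forallNP h.
have := @nonincreasing_cvg_mu _ _ _ m F (m_fin (mF 0)) mF (bigcapT_measurable mF) niF.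
move=> Fc; have : (e'%:E <= m (\bigcap_k F k))%E.
  rewrite -(cvg_lim _ Fc)//; apply: lime_ge; first by apply/cvg_ex; eexists; exact: Fc.
  by apply: nearW => k; rewrite leNgt; apply/negP => /ltW; exact: h.
by rewrite leNgt => /negP; apply; apply: le_lt_trans Fe _; rewrite lte_fin.
Qed.

Let approx_open (U : set 'cV[R]_n) : open U -> approx U.
Proof.
move=> oU e e0; have [K [cK ndK KU]] := open_sigma_compact oU.
have clK k : closed (K k) by apply: compact_closed => //; exact: norm_hausdorff.
have [k Uk] : exists k, (m (U `\` K k) <= e%:E)%E.
  apply: (@small_tail (fun k => U `\` K k) 0).
  - by move=> k; apply: measurableD; [exact: sub_sigma_algebra|exact: borel_closed].
  - by move=> i j ij; apply/subsetPset; apply: setDS; exact/subsetPset/ndK.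
  - rewrite (_ : \bigcap_k _ = set0) ?measure0//; apply/seteqP; split => // x UKx.
    have [] := UKx 0 Logic.I; rewrite -{1}KU => -[k _ Kx] _.
    by have [_] := UKx k Logic.I.
  - by [].
by exists (K k), U; split => //; rewrite -KU; exact: bigcup_sup.
Qed.

Let approxC (A : set X) : approx A -> approx (setT `\` A).
Proof.
move=> hA e /hA[F [U [cF oU FA AU UF]]]; exists (~` U), (~` F); split.
- exact: open_closedC.
- exact: closed_openC.
- by rewrite setTD; exact: subsetC.
- by rewrite setTD; exact: subsetC.
- by rewrite setDE setCK setIC -setDE.
Qed.

Let approx_bigcup (A : nat -> set X) : (forall k, approx (A k)) -> approx (\bigcup_k A k).
Proof.
move=> hA e e0.
have e2 : 0 < e / 2 by rewrite divr_gt0.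
have ek k : 0 < e / 2 / (2 ^ k.+1)%:R by rewrite divr_gt0// ltr0n expn_gt0.
have [F /choice[U FU]] := choice (fun k => hA k _ (ek k)).
pose V := \bigcup_k U k.
(* An infinite union of closed sets need not be closed, so it is truncated. The geometric errors use
   [e / 2] in total and the truncation uses the rest. *)
pose G N := \bigcup_(k < N) F k.
have oV : open V by apply: bigcup_open => k _; case: (FU k).
have cG N : closed (G N).
  by apply: closed_bigcup => [|k _]; [exact: finite_II|case: (FU k)].
have mF k : measurable (F k : set X) by apply: borel_closed; case: (FU k).
have mU k : measurable (U k : set X) by apply: sub_sigma_algebra; case: (FU k).
have mV : measurable (V : set X) by exact: sub_sigma_algebra.
have [N GN] : exists N, (m (V `\` G N) <= e%:E)%E.
  apply: (@small_tail (fun N => V `\` G N) (e / 2)).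
  - by move=> k; apply: measurableD => //; exact: borel_closed.
  - move=> i j ij; apply/subsetPset; apply: setDS => x [k /= ki Fx].
    by exists k => //=; exact: leq_trans ki ij.
  - apply: (@le_trans _ _ (\sum_(0 <= k <oo) m (U k `\` F k))%E).
      apply: measure_sigma_subadditive.
      + by move=> k; exact: measurableD.
      + apply: bigcapT_measurable => k.
        by apply: measurableD => //; exact: borel_closed.
      + move=> x Vx; have [k _ Ukx] : V x by have [] := Vx 0%N Logic.I.
        exists k => //; split => // Fkx.
        by have [_] := Vx k.+1 Logic.I; apply; exists k => /=.
    apply: le_trans (epsilon_trick0 _ (ltW e2)).
    apply: lee_nneseries => // k _.
    by case: (FU k).
  - by rewrite ltr_pdivrMr// ltr_pMr// ltr1n.
exists (G N), V; split => //.
- by move=> x [k _ Fkx]; exists k => //; case: (FU k) => _ _ + _ _; apply.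
- by move=> x [k _ Akx]; exists k => //; case: (FU k) => _ _ _ + _; apply.
Qed.

Lemma finite_measure_approx (A : set X) : measurable A -> forall e : R, 0 < e ->
  exists F U : set 'cV[R]_n,
    [/\ closed F, open U, F `<=` A, A `<=` U & (m (U `\` F) <= e%:E)%E].
Proof.
move=> mA; suff : approx A by [].
apply: (smallest_sub _ _ mA); last by move=> U; exact: approx_open.
split.
- move=> e e0; exists set0, set0; split => //; first exact: closed0.
  by rewrite setD0 measure0 lee_fin ltW.
- exact: approxC.
- exact: approx_bigcup.
Qed.
End FiniteMeasure.

(** Localise to open balls of finite mass, apply the finite case in each with error [e / 2^(k+1)],
    and glue the open sets. *)
Lemma outer_regular (mu : {measure set X -> \bar R}) (A : set X) :
  (forall k : nat, (mu (cube k%:R) < +oo)%E) -> measurable A ->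
  mu A = ereal_inf [set mu U | U in [set U : set 'cV[R]_n | open U /\ A `<=` U]].
Proof.
move=> muoo mA; apply/eqP; rewrite eq_le; apply/andP; split.
  apply: le_ereal_inf_tmp => _ [U [oU AU] <-].
  by apply: le_measure; rewrite ?inE//; exact: sub_sigma_algebra.
have [Aoo|] := ltP (mu A) +oo%E; last by rewrite leye_eq => /eqP ->; rewrite leey.
apply/lee_addgt0Pr => e e0.
pose B k : set X := ball (0 : 'cV[R]_n) k.+1%:R.
have mB k : measurable (B k) by apply: sub_sigma_algebra; exact: ball_open.
have Boo k : (mu (B k) < +oo)%E.
  apply: le_lt_trans (muoo k.+1); apply: le_measure; rewrite ?inE//.
    exact: cube_measurable.
  move=> x; rewrite /B mx_norm_ball /ball_/= sub0r normrN => xk i.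
  exact: le_trans (normr_cV_le x i) (ltW xk).
have ek k : 0 < e / (2 ^ k.+1)%:R by rewrite divr_gt0// ltr0n expn_gt0.
have /choice[U UP] k : exists U : set 'cV[R]_n, [/\ open U, A `<=` U
    & (mu ((U `\` A) `&` B k) <= (e / (2 ^ k.+1)%:R)%:E)%E].
  have [F [U [cF oU FA AU UF]]] := finite_measure_approx (mfrestr (mB k) (Boo k)) mA (ek k).
  exists U; split => //; apply: le_trans UF; apply: le_measure; rewrite ?inE.
  - apply: measurableI => //; apply: measurableD => //; exact: sub_sigma_algebra.
  - apply: measurableI => //; apply: measurableD => //; first exact: sub_sigma_algebra.
    exact: borel_closed.
  - by apply: setSI; apply: setDS.
(* The excess of [U k] over [A] is controlled only within [B k], hence the intersection; it is open
   since the balls are. *)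
pose V := \bigcup_k (U k `&` B k).
have oV : open V.
  by apply: bigcup_open => k _; apply: openI; [case: (UP k)|exact: ball_open].
have mV : measurable (V : set X) by exact: sub_sigma_algebra.
have AV : A `<=` V.
  move=> x Ax; exists (Num.truncn `|x|) => //; split.
    by case: (UP (Num.truncn `|x|)) => _ + _; apply.
  by rewrite /B mx_norm_ball /ball_/= sub0r normrN truncnS_gt.
apply: (@le_trans _ _ (mu V)); first by apply: ereal_inf_lbound; exists V.
rewrite -[in leLHS](setDUK AV) measureU//; [|exact: measurableD|by rewrite setDIK].
rewrite leeD2l//.
apply: (@le_trans _ _ (\sum_(0 <= k <oo) mu ((U k `\` A) `&` B k))%E).
  apply: measure_sigma_subadditive.
  - move=> k; apply: measurableI => //; apply: measurableD => //.
    by apply: sub_sigma_algebra; case: (UP k).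
  - exact: measurableD.
  - by move=> x [[k _ [Ux Bx]] Ax]; exists k.
apply: le_trans (epsilon_trick0 _ (ltW e0)).
by apply: lee_nneseries => // k _; case: (UP k).
Qed.

End Regularity.

(** * Relatively invariant measures on the homogeneous space *)

Definition image_measure d d' (T : measurableType d) (U : measurableType d')
    (R : realType) (mu : {measure set T -> \bar R}) (f : T -> U)
    (mf : measurable_fun setT f) : {measure set U -> \bar R}.
Proof. by apply: (pushforward mu f). Defined.

Lemma ge0_integral_image_measure d d' (T : measurableType d) (U : measurableType d')
    (R : realType) (mu : {measure set T -> \bar R}) (f : T -> U)
    (mf : measurable_fun setT f) (D : set U) (g : U -> \bar R) :
  measurable D -> measurable_fun D g -> (forall y, D y -> 0 <= g y)%E ->
  (\int[image_measure mu mf]_(y in D) g y = \int[mu]_(x in f @^-1` D) g (f x))%E.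
Proof.
move=> mD mg g0; apply: (ge0_integral_pushforward mf mu mD mg) => y.
by rewrite inE; exact: g0.
Qed.

Section AffineAction.
Context (R : realType) (n : nat).
Local Notation X := (homspace (@GLsub R n)).

(** The action of G on G/H read in the coordinate [b]; [homspace_trans_act] makes this precise. *)
Definition aff_act (g : affine R n) (b : 'cV[R]_n) : 'cV[R]_n :=
  aff_lin g *m b + aff_trans g.

Lemma aff_linM (g k : affine R n) : aff_lin (g * k)%g = aff_lin g *m aff_lin k.
Proof. by []. Qed.

Lemma aff_transM (g k : affine R n) :
  aff_trans (g * k)%g = aff_lin g *m aff_trans k + aff_trans g.
Proof. by []. Qed.

Lemma aff_lin1 : aff_lin (1%g : affine R n) = 1%:M.
Proof. by []. Qed.

Lemma aff_trans1 : aff_trans (1%g : affine R n) = 0.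
Proof. by []. Qed.

Lemma lin_translation (w : 'cV[R]_n) : aff_lin (translation w) = 1%:M.
Proof. by []. Qed.

Lemma trans_translation (w : 'cV[R]_n) : aff_trans (translation w) = w.
Proof. by []. Qed.

Lemma aff_actM (g k : affine R n) b : aff_act (g * k)%g b = aff_act g (aff_act k b).
Proof.
by rewrite /aff_act aff_linM aff_transM mulmxDr mulmxA addrA.
Qed.

Lemma aff_act1 b : aff_act 1%g b = b.
Proof.
by rewrite /aff_act aff_lin1 aff_trans1 mul1mx addr0.
Qed.

Lemma aff_actK g : cancel (aff_act g) (aff_act g^-1%g).
Proof. by move=> b; rewrite -aff_actM mulVg aff_act1. Qed.

Lemma aff_actKV g : cancel (aff_act g^-1%g) (aff_act g).
Proof. by move=> b; rewrite -aff_actM mulgV aff_act1. Qed.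

Lemma aff_act_translation (w b : 'cV[R]_n) : aff_act (translation w) b = b + w.
Proof. by rewrite /aff_act lin_translation trans_translation mul1mx. Qed.

Lemma aff_act_continuous g : continuous (aff_act g).
Proof.
move=> b; exact: (@cvgD R 'cV[R]_n _ (nbhs b) _ _ (fun=> aff_trans g) _ _
  (@continuous_mulmxl _ _ _ (aff_lin g) b) (cvg_cst (aff_trans g))).
Qed.

Lemma homspace_trans_act (g : affine R n) (x : X) :
  homspace_trans (homspace_act g x) = aff_act g (homspace_trans x).
Proof. by rewrite /homspace_act homspace_transE. Qed.

Lemma preimage_aff_act_measurable g (A : set (borel 'cV[R]_n)) : measurable A ->
  measurable (aff_act g @^-1` A : set (borel 'cV[R]_n)).
Proof.
move=> mA; rewrite -[X in measurable X]setTI.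
exact: (continuous_borel_measurable (@aff_act_continuous g)).
Qed.

(** With ratio 2, conjugation sends a translation to its square, so a character equals its own
    square there. *)
Definition homothety2 : affine R n.
Proof.
refine (@Affine R n (2%:M, 0) _) => /=.
by rewrite unitmxE det_scalar unitfE expf_neq0// pnatr_eq0.
Defined.

(* Translations are commutators with a homothety: this kills every character of
   the affine group on them. *)
Lemma translation_commutator (w : 'cV[R]_n) :
  (homothety2 * translation w = translation w * translation w * homothety2)%g.
Proof.
apply: affine_eq; rewrite !(aff_linM, aff_transM) !(lin_translation, trans_translation).
  by rewrite !mulmx1 mul1mx.
rewrite [aff_lin _]/(2%:M) [aff_trans homothety2]/(0 : 'cV[R]_n).
by rewrite mulmx0 add0r addr0 mul1mx mul_scalar_mx scaler_nat mulr2n.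
Qed.

(** Write [g] as a translation times a linear part: the commutator identity kills [tau] on the
    first, and the second lies in H. *)
Lemma W0_eq0 (tau : affine R n -> R) : W0 (@GLsub R n) tau -> tau = fun=> 0.
Proof.
move=> [_ tauD tauH]; apply/funext => g.
have tau_t w : tau (translation w) = 0.
  have := congr1 tau (translation_commutator w); rewrite !tauD => h.
  by apply: (addrI (tau (translation w))); rewrite addr0; lra.
pose l : affine R n := @Affine R n (aff_lin g, 0) (lin_unit g).
have -> : g = (translation (aff_trans g) * l)%g.
  apply: affine_eq; rewrite (aff_linM, aff_transM) (lin_translation, trans_translation).
    by rewrite mul1mx.
  by rewrite [aff_trans l]/(0 : 'cV[R]_n) mul1mx add0r.
rewrite tauD tau_t add0r; apply: tauH.
by rewrite inE.
Qed.

Local Open Scope ereal_scope.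

Lemma lebesgue_cV_setT_neq0 : @lebesgue_cV R n setT != 0.
Proof.
have : @lebesgue_cV R n (cube 1) <= @lebesgue_cV R n setT.
  by apply: le_measure; rewrite ?inE//; exact: cube_measurable.
rewrite lebesgue_cV_cube// mulr1; apply: contraTneq => ->.
by rewrite lee_fin -ltNge exprn_gt0.
Qed.

(** The image of Lebesgue measure under [g] is again translation invariant and finite on cubes, so
    uniqueness gives [c]; it is nonzero because the total mass is. *)
Lemma lebesgue_cV_aff_act (g : affine R n) : exists2 c : R, (0 < c)%R &
  forall A : set (borel 'cV[R]_n), measurable A ->
    @lebesgue_cV R n (aff_act g @^-1` A) = c%:E * @lebesgue_cV R n A.
Proof.
pose mu := pushforward (@lebesgue_cV R n)
  (aff_act g : borel 'cV[R]_n -> borel 'cV[R]_n).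
have mg : measurable_fun setT (aff_act g : borel 'cV[R]_n -> borel 'cV[R]_n).
  exact: continuous_borel_measurable (@aff_act_continuous g).
have tmu : translation_invariant mu.
  move=> w A mA; rewrite /mu /pushforward.
  (* Translating by [w'] before applying [g] amounts to translating by [w] afterwards. *)
  pose w' := (invmx (aff_lin g) *m w)%R.
  have act_w' b : (aff_act g (b + w') = aff_act g b + w)%R.
    by rewrite /aff_act mulmxDr /w' mulmxA mulmxV ?lin_unit// mul1mx addrAC.
  have -> : aff_act g @^-1` ((fun v => v + w)%R @^-1` A) =
            (fun v => v + w')%R @^-1` (aff_act g @^-1` A).
    by apply/seteqP; split => b /=; rewrite act_w'.
  by apply: lebesgue_cV_translation; exact: preimage_aff_act_measurable.
have muoo k : mu (cube k%:R) < +oo.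
  (* The preimage of a cube is its image under the inverse of [g], hence compact and inside a larger
     cube. *)
  have [l gl] : exists l : nat, aff_act g @^-1` cube k%:R `<=` @cube R n l%:R.
    apply: compact_sub_cube.
    have -> : aff_act g @^-1` cube k%:R = aff_act g^-1%g @` cube k%:R.
      apply/seteqP; split => [b kb|_ [b kb <-]]/=.
        by exists (aff_act g b) => //; rewrite aff_actK.
      by rewrite aff_actKV.
    apply: continuous_compact; last exact: cube_compact.
    exact/continuous_subspaceT/aff_act_continuous.
  apply: (@le_lt_trans _ _ (@lebesgue_cV R n (cube l%:R))).
    rewrite /mu /pushforward; apply: le_measure; rewrite ?inE//; last exact: cube_measurable.
    by apply: preimage_aff_act_measurable; exact: cube_measurable.
  by rewrite lebesgue_cV_cube// ltry.
have [c cE] := translation_invariantE tmu muoo.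
exists c%:num => //; rewrite lt_neqAle eq_sym andbC; apply/andP; split => //.
apply/eqP => c0.
have := cE setT measurableT; rewrite c0 mul0e => /eqP.
exact/negP/lebesgue_cV_setT_neq0.
Qed.

End AffineAction.

(** * Transport of measures between G/H and R^n *)

Section HomogeneousMeasure.
Context (R : realType) (n : nat).
Local Notation X := (homspace (@GLsub R n)).
Local Notation h := (@homspace_trans R n).

Definition homspace_of (b : 'cV[R]_n) : X := \pi_X%qT (translation b).

Lemma homspace_transVK : cancel h homspace_of.
Proof. exact: homspace_transK. Qed.

Lemma homspace_ofK : cancel homspace_of h.
Proof. exact: translationK. Qed.

Lemma measurable_homspace_trans :
  measurable_fun setT (h : borel X -> borel 'cV[R]_n).
Proof. exact: continuous_borel_measurable (@homspace_trans_continuous R n). Qed.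

Lemma measurable_homspace_of :
  measurable_fun setT (homspace_of : borel 'cV[R]_n -> borel X).
Proof. exact: continuous_borel_measurable (@homspace_translation_continuous R n). Qed.

Lemma preimage_homspace_trans (A : set 'cV[R]_n) : h @^-1` A = homspace_of @` A.
Proof.
apply/seteqP; split => [x Ax|_ [b Ab <-]] /=; last by rewrite homspace_ofK.
by exists (h x) => //; rewrite homspace_transVK.
Qed.

Lemma preimage_homspace_of (A : set X) : homspace_of @^-1` A = h @` A.
Proof.
apply/seteqP; split => [b Ab|_ [x Ax <-]] /=; last by rewrite homspace_transVK.
by exists (homspace_of b) => //; rewrite homspace_ofK.
Qed.

Lemma preimage_homspace_ofK (A : set X) : h @^-1` (homspace_of @^-1` A) = A.
Proof.
by rewrite -comp_preimage (_ : _ \o _ = id)//; apply/funext => x /=; rewrite homspace_transVK.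
Qed.

Lemma preimage_homspace_transK (A : set 'cV[R]_n) : homspace_of @^-1` (h @^-1` A) = A.
Proof. by rewrite -comp_preimage (_ : _ \o _ = id)//; apply/funext => x /=; rewrite homspace_ofK. Qed.

Lemma open_preimage_homspace_trans (A : set 'cV[R]_n) : open A -> open (h @^-1` A).
Proof. by move: A; exact/continuousP/homspace_trans_continuous. Qed.

Lemma open_preimage_homspace_of (A : set X) : open A -> open (homspace_of @^-1` A).
Proof. by move: A; exact/continuousP/homspace_translation_continuous. Qed.

Lemma compact_preimage_homspace_trans (A : set 'cV[R]_n) : compact A -> compact (h @^-1` A).
Proof.
move=> cA; rewrite preimage_homspace_trans; apply: continuous_compact => //.
exact/continuous_subspaceT/homspace_translation_continuous.
Qed.

Lemma compact_preimage_homspace_of (A : set X) : compact A -> compact (homspace_of @^-1` A).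
Proof.
move=> cA; rewrite preimage_homspace_of; apply: continuous_compact => //.
exact/continuous_subspaceT/homspace_trans_continuous.
Qed.

Local Open Scope ereal_scope.

(** The witness for the existence of an admissible measure on G/H. *)
Definition homspace_lebesgue : {measure set (borel X) -> \bar R} :=
  @image_measure _ _ (borel 'cV[R]_n) (borel X) R (@lebesgue_cV R n) homspace_of
    measurable_homspace_of.

Lemma homspace_lebesgueE (A : set (borel X)) :
  homspace_lebesgue A = @lebesgue_cV R n (homspace_of @^-1` A).
Proof. by []. Qed.

Lemma measurable_preimage_homspace_trans (A : set (borel 'cV[R]_n)) :
  measurable A -> measurable (h @^-1` A : set (borel X)).
Proof. by move=> mA; rewrite -[X in measurable X]setTI; exact: measurable_homspace_trans. Qed.

Lemma measurable_preimage_homspace_of (A : set (borel X)) :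
  measurable A -> measurable (homspace_of @^-1` A : set (borel 'cV[R]_n)).
Proof. by move=> mA; rewrite -[X in measurable X]setTI; exact: measurable_homspace_of. Qed.

Lemma lebesgue_cube_fin (k : nat) : @lebesgue_cV R n (cube k%:R) < +oo.
Proof. by rewrite lebesgue_cV_cube// ltry. Qed.

(** The coordinate is a homeomorphism, so open and compact sets correspond and regularity is
    inherited from R^n. *)
Lemma homspace_lebesgue_radon : radon homspace_lebesgue.
Proof.
split.
- move=> K cK; rewrite homspace_lebesgueE.
  have cK' := compact_preimage_homspace_of cK.
  have [k Kk] := compact_sub_cube cK'.
  apply: le_lt_trans (lebesgue_cube_fin k); apply: le_measure; rewrite ?inE//.
    by apply: borel_closed; apply: compact_closed => //; exact: norm_hausdorff.
  exact: cube_measurable.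
- move=> A mA; rewrite homspace_lebesgueE.
  rewrite (outer_regular lebesgue_cube_fin (measurable_preimage_homspace_of mA)).
  congr ereal_inf; apply/seteqP; split => _ [U [oU AU] <-].
    exists (h @^-1` U); last by rewrite homspace_lebesgueE preimage_homspace_transK.
    split; first exact: open_preimage_homspace_trans.
    by move=> x Ax; apply: AU; rewrite /= homspace_transVK.
  exists (homspace_of @^-1` U) => //; split; first exact: open_preimage_homspace_of.
  by move=> x Ax; exact: AU.
- move=> U oU; rewrite homspace_lebesgueE (inner_regular_open _ (open_preimage_homspace_of oU)).
  congr ereal_sup; apply/seteqP; split => _ [K [cK KU] <-].
    exists (h @^-1` K); last by rewrite homspace_lebesgueE preimage_homspace_transK.
    split; first exact: compact_preimage_homspace_trans.
    by move=> x /KU /=; rewrite homspace_transVK.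
  exists (homspace_of @^-1` K) => //; split; first exact: compact_preimage_homspace_of.
  by move=> x Kx; exact: KU.
Qed.

Lemma preimage_homspace_act g (A : set 'cV[R]_n) :
  homspace_act g @^-1` (h @^-1` A) = h @^-1` (aff_act g @^-1` A).
Proof. by apply/seteqP; split => x /=; rewrite homspace_trans_act. Qed.

Lemma homspace_lebesgue_admissible : admissible homspace_lebesgue.
Proof.
split; [exact: lebesgue_cV_setT_neq0|exact: homspace_lebesgue_radon|].
have /choice[c cP] g : exists c : R, (0 < c)%R /\
    forall A : set (borel 'cV[R]_n), measurable A ->
      @lebesgue_cV R n (aff_act g @^-1` A) = c%:E * @lebesgue_cV R n A.
  by have [c] := lebesgue_cV_aff_act g; exists c.
(* Relative invariance is stated with the inverse of [chi], so [chi] is the inverse of the scaling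
   factor. *)
exists (fun g => (c g)^-1%R) => [g|g A mA]; first by rewrite invr_gt0; case: (cP g).
rewrite invrK homspace_lebesgueE; have [_ <-] := cP g; last exact: measurable_preimage_homspace_of.
rewrite /pushforward homspace_lebesgueE -[in LHS](preimage_homspace_ofK A).
by rewrite preimage_homspace_act preimage_homspace_transK.
Qed.

Section Admissible.
Variable nu : {measure set (borel X) -> \bar R}.
Hypothesis nuA : admissible nu.
Let mu : {measure set (borel 'cV[R]_n) -> \bar R} :=
  @image_measure _ _ (borel X) (borel 'cV[R]_n) R nu h measurable_homspace_trans.

Let muE A : mu A = nu (h @^-1` A). Proof. by []. Qed.

Let mu_cube (k : nat) : mu (cube k%:R) < +oo.
Proof.
case: nuA => _ [nuK _ _] _.
exact: (nuK _ (compact_preimage_homspace_trans (@cube_compact R n k%:R))).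
Qed.

Let mu_neq0 : mu setT != 0.
Proof. by case: nuA. Qed.

Let mu_cube_neq0 : exists k : nat, mu (cube k%:R) != 0.
Proof.
apply: contrapT => /forallNP h0; move/negP: mu_neq0; apply.
rewrite -measure_le0 -(cube_cover R n).
(* If all cubes were null, countable subadditivity would make the whole space null. *)
apply: le_trans (_ : _ <= \sum_(0 <= k <oo) mu (cube k%:R)) _.
  apply: measure_sigma_subadditive => //.
  - by move=> k; exact: cube_measurable.
  - by apply: bigcupT_measurable => k; exact: cube_measurable.
by rewrite eseries0// => k _ _; apply/eqP/negPn/negP/h0.
Qed.

(** Relative invariance provides only a positive function [chi]. It is shown to be multiplicative,
    and the commutator identity then forces the value 1 on translations. *)
Lemma admissible_translation_invariant : translation_invariant mu.
Proof.
have [_ _ [chi chi0 chiE]] := nuA.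
have act g (A : set (borel 'cV[R]_n)) : measurable A ->
    mu (aff_act g @^-1` A) = (chi g)^-1%:E * mu A.
  move=> mA; rewrite !muE -preimage_homspace_act.
  exact: (chiE g _ (measurable_preimage_homspace_trans mA)).
have [k k0] := mu_cube_neq0.
(* Apply the invariance twice to a cube of finite nonzero mass and cancel that mass. *)
have chiM g1 g2 : chi (g1 * g2)%g = (chi g1 * chi g2)%R.
  have mc := @cube_measurable R n k%:R.
  have := act (g1 * g2)%g _ mc.
  have -> : aff_act (g1 * g2)%g @^-1` cube k%:R =
      aff_act g2 @^-1` (aff_act g1 @^-1` (@cube R n k%:R)).
    by apply/seteqP; split => b /=; rewrite aff_actM.
  rewrite act; last exact: preimage_aff_act_measurable.
  rewrite act// muleA -EFinM.
  have fK : mu (cube k%:R) \is a fin_num by rewrite ge0_fin_numE//; exact: mu_cube.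
  have fK0 : fine (mu (cube k%:R)) != 0%R by rewrite fine_eq0.
  rewrite -(fineK fK) -!EFinM => -[] /(mulIf fK0) /(congr1 GRing.inv).
  by rewrite invfM !invrK mulrC => ->.
move=> w A mA.
have -> : (fun v : 'cV[R]_n => v + w)%R @^-1` A = aff_act (translation w) @^-1` A.
  by apply/seteqP; split => b /=; rewrite aff_act_translation.
rewrite act//; suff -> : chi (translation w) = 1%R by rewrite invr1 mul1e.
have := congr1 chi (translation_commutator w); rewrite !chiM.
have n0 g : chi g != 0%R by rewrite gt_eqF.
rewrite mulrC => /(mulIf (n0 _)) E.
by apply: (mulfI (n0 (translation w))); rewrite mulr1.
Qed.

Lemma admissibleE : exists2 c : {nonneg R}, (0 < c%:num)%R &
  forall A : set (borel 'cV[R]_n), measurable A ->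
    nu (h @^-1` A) = c%:num%:E * @lebesgue_cV R n A.
Proof.
have [c cE] := translation_invariantE admissible_translation_invariant mu_cube.
exists c => [|A mA]; last by rewrite -muE; exact: cE.
rewrite lt_neqAle eq_sym andbC; apply/andP; split => //.
apply/eqP => c0; move/eqP: mu_neq0; apply.
by rewrite cE// c0 mul0e.
Qed.

Lemma admissible_integral : exists2 c : R, (0 < c)%R &
  forall (f : borel 'cV[R]_n -> R) (A : set (borel 'cV[R]_n)),
    measurable_fun setT f -> (forall x, 0 <= f x)%R -> measurable A ->
    \int[nu]_(x in h @^-1` A) (f (h x))%:E = c%:E * \int[@lebesgue_cV R n]_(v in A) (f v)%:E.
Proof.
have [c c0 cE] := admissibleE.
exists c%:num => // f A mf f0 mA.
have mfA : measurable_fun A (fun v => (f v)%:E).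
  exact/measurable_EFinP/measurable_funTS.
rewrite -ge0_integral_mscale//; last by move=> x _; rewrite lee_fin.
transitivity (\int[mu]_(v in A) (f v)%:E).
  have f0A v : A v -> 0 <= (f v)%:E by move=> _; rewrite lee_fin.
  exact: (esym (ge0_integral_image_measure nu measurable_homspace_trans mA mfA f0A)).
apply: eq_measure_integral => B mB _; rewrite muE; exact: cE.
Qed.
End Admissible.
End HomogeneousMeasure.

(** * Normal densities and linear forms on symmetric matrices *)

Section NormalDensity.
Context (R : realType) (n : nat).
Implicit Types (S P M : 'M[R]_n) (m q : 'cV[R]_n).

Lemma Sym_pos_unit S : Sym_pos S -> S \in unitmx.
Proof. by move=> /Sym_pos_det S0; rewrite unitmxE unitfE gt_eqF. Qed.

Lemma Sym_pos_inv S : Sym_pos S -> Sym_pos (invmx S).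
Proof.
move=> pS; have uS := Sym_pos_unit pS; have [sS pS'] := pS.
have sI : (invmx S)^T = invmx S by rewrite trmx_inv sS.
split=> // x x0.
have := pS' (invmx S *m x); rewrite trmx_mul sI -!mulmxA [S *m _]mulmxA mulmxV// mul1mx.
apply; apply: contraNneq x0 => /(congr1 (mulmx S)).
by rewrite mulmxA mulmxV// mul1mx mulmx0 => ->.
Qed.

Lemma Sym_pos_scale S (k : R) : 0 < k -> Sym_pos S -> Sym_pos (k *: S).
Proof.
move=> k0 [sS pS]; split=> [|x x0]; first by rewrite linearZ/= sS.
by rewrite -scalemxAr -scalemxAl mxE mulr_gt0// pS.
Qed.

Lemma measurable_normal_density S m :
  measurable_fun setT (normal_density S m : borel 'cV[R]_n -> R).
Proof.
apply: measurable_funM; first exact: measurable_cst.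
apply/measurable_EFinP.
exact: measurableT_comp (measurable_expR_quad (invmx S) (- 2^-1)) (measurable_addcVr (- m)).
Qed.

Lemma normal_density_ge0 S m x : 0 <= normal_density S m x.
Proof. by rewrite mulr_ge0 ?expR_ge0// invr_ge0 sqrtr_ge0. Qed.

Lemma integral_normal_density S m : Sym_pos S ->
  (\int[@lebesgue_cV R n]_x (normal_density S m x)%:E = 1)%E.
Proof.
move=> pS; have pI := Sym_pos_inv pS.
rewrite -(ge0_integral_lebesgue_cV_shift (f := fun x => (normal_density S m x)%:E) m)//; first last.
- by move=> x; rewrite lee_fin normal_density_ge0.
- by apply/measurable_EFinP; exact: measurable_normal_density.
have d0 := Sym_pos_det pS.
have s0 : 0 < Num.sqrt ((2 * pi) ^+ n * \det S).
  by rewrite sqrtr_gt0 mulr_gt0// exprn_gt0// mulr_gt0// pi_gt0.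
transitivity (\int[@lebesgue_cV R n]_x ((Num.sqrt ((2 * pi) ^+ n * \det S))^-1%:E *
    (expR (- 2^-1 * quad (invmx S) x))%:E))%E.
  by apply: eq_integral => x _; rewrite /normal_density addrK EFinM.
rewrite ge0_integralZl//=; last exact: (measurable_expR_quad _ (- 2^-1)).
by rewrite integral_gauss// det_inv invrK -EFinM mulVf// gt_eqF.
Qed.

Lemma quad_scale S (k : R) x : quad (k *: S) x = k * quad S x.
Proof. by rewrite /quad -scalemxAr -scalemxAl mxE. Qed.

(* Completing the square. *)
Lemma qexp_normal_density S m (r : R) : Sym_pos S -> exists2 k : R, 0 < k &
  forall x, qexp (2^-1 *: invmx S) (- (invmx S *m m)) r x = k * normal_density S m x.
Proof.
move=> pS; have [sI _] := Sym_pos_inv pS; have d0 := Sym_pos_det pS.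
set z := Num.sqrt ((2 * pi) ^+ n * \det S).
have z0 : 0 < z.
  by rewrite sqrtr_gt0 mulr_gt0// exprn_gt0// mulr_gt0// pi_gt0.
(* The constant left over by the square, times the factor [z] that undoes the normalisation of the
   density. *)
exists (expR (2^-1 * quad (invmx S) m - r) * z).
  by rewrite mulr_gt0// expR_gt0.
move=> x; rewrite /normal_density -/z -[X in - 2^-1 * X]/(quad (invmx S) (x - m)).
rewrite -mulrA mulVKf ?gt_eqF// -expRD; congr expR.
have tM : (- (invmx S *m m))^T = - (m^T *m invmx S).
  by rewrite linearN/= trmx_mul sI.
have Nm : quad (invmx S) (- m) = quad (invmx S) m.
  by rewrite -scaleN1r quadZ sqrrN expr1n mul1r.
have xm : (x^T *m invmx S *m - m) 0 0 = - (m^T *m invmx S *m x) 0 0.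
  have E : (m^T *m invmx S *m x)^T = x^T *m invmx S *m m.
    by rewrite !trmx_mul trmxK sI mulmxA.
  by rewrite mulmxN mxE -E [in LHS]mxE.
rewrite quadD// Nm xm quad_scale tM mulNmx mxE.
by set a := (_ *m x) 0 0; field.
Qed.

Lemma quad_symmetrize P x : quad (2^-1 *: (P + P^T)) x = quad P x.
Proof.
have t : (x^T *m P^T *m x) 0 0 = quad P x.
  have E : x^T *m P^T *m x = (x^T *m P *m x)^T by rewrite !trmx_mul trmxK mulmxA.
  by rewrite E mxE.
rewrite quad_scale {1}/quad mulmxDr mulmxDl mxE t -/(quad P x).
by field.
Qed.

Lemma Sym_pos_qexp P q : Sym_pos P -> exists S m, [/\ Sym_pos S,
  P = 2^-1 *: invmx S & q = - (invmx S *m m)].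
Proof.
move=> pP; have p2 : Sym_pos (2 *: P) by exact: Sym_pos_scale.
exists (invmx (2 *: P)), (- (invmx (2 *: P) *m q)); split.
- exact: Sym_pos_inv.
- by rewrite invmxK scalerA mulVf ?scale1r.
- by rewrite invmxK mulmxN mulmxA mulmxV ?Sym_pos_unit// mul1mx opprK.
Qed.

End NormalDensity.

(** * Linear forms on symmetric matrices as traces *)

Section DualSym.
Context (R : realType) (n : nat).

Definition trace_form (M : 'M[R]_(n + 1)) (S : Sym R (n + 1)) : R^o :=
  \tr (M *m vsval S).

Lemma trace_form_linear M : linear (trace_form M).
Proof.
move=> a S T; rewrite /trace_form.
have -> : vsval (a *: S + T) = a *: vsval S + vsval T by rewrite linearP.
by rewrite /trace_form mulmxDr -scalemxAr mxtraceD mxtraceZ.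
Qed.

HB.instance Definition _ M := GRing.isLinear.Build R (Sym R (n + 1)) R^o _
  (trace_form M) (trace_form_linear M).

(** Extend [phi] to all matrices by the projection [vsproj]; its values on matrix units are the
    entries of [M], which need not be symmetric. The indices are swapped because the trace pairs the
    entry (i, j) of [M] with the entry (j, i) of [S]. *)
Lemma dual_SymP (phi : 'Hom(Sym R (n + 1), R^o)) :
  exists M, forall S, phi S = trace_form M S.
Proof.
exists (\matrix_(i, j) phi (vsproj (symv R (n + 1)) (delta_mx j i))) => S.
rewrite -{1}(vsvalK S) [in LHS](matrix_sum_delta (vsval S)).
rewrite /trace_form /mxtrace !linear_sum/=.
under [RHS]eq_bigr do rewrite mxE.
rewrite exchange_big/=; apply: eq_bigr => i _.
rewrite !linear_sum/=; apply: eq_bigr => j _.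
by rewrite !linearZ/= mxE mulrC.
Qed.

Lemma affine_mx_E_last (g : affine R n) (w := col_mx (aff_trans g) (1%:M : 'M[R]_1)) :
  vsval (sym_rep g (E_last R n)) = w *m w^T.
Proof.
have wE : affine_mx g *m delta_mx (rshift n (0 : 'I_1)) (0 : 'I_1) = w.
  by rewrite -colE /affine_mx block_mxEh colKr col_id.
rewrite sym_repE /= -(mul_delta_mx (0 : 'I_1)) mulmxA -mulmxA.
by rewrite -[delta_mx 0 _]trmxK trmx_delta -trmx_mul wE.
Qed.

Lemma trace_form_E_last (M : 'M[R]_(n + 1)) (g : affine R n) (b := aff_trans g) :
  trace_form M (sym_rep g (E_last R n)) =
  quad (ulsubmx M) b + ((ursubmx M + (dlsubmx M)^T)^T *m b) 0 0 + drsubmx M 0 0.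
Proof.
(* Cyclicity of the trace turns tr(M w w^T) into the scalar w^T M w, which is then expanded in
   blocks. *)
rewrite /trace_form affine_mx_E_last mulmxA mxtrace_mulC -/b mulmxA.
rewrite -{1}(submxK M) tr_col_mx mul_row_block mul_row_col /mxtrace big_ord1.
rewrite trmx1 !mul1mx !mulmx1 mulmxDl.
have H (u v : 'M[R]_1) : (u + v) 0 0 = u 0 0 + v 0 0 by rewrite mxE.
rewrite !H linearD/= mulmxDl trmxK H /quad.
have -> : (b^T *m ursubmx M) 0 0 = ((ursubmx M)^T *m b) 0 0.
  by rewrite -[in RHS](trmxK b) -trmx_mul [RHS]mxE.
by ring.
Qed.
End DualSym.

(** * The representation, its fixed vector and the resulting densities *)

Section SymmetricRepresentation.
Context (R : realType) (n : nat).

Lemma GLsub_closed : closed [set g : affine R n | g \in @GLsub R n].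
Proof.
rewrite (_ : [set g | _] = @aff_trans R n @^-1` [set 0]); last first.
  by apply/seteqP; split => g; rewrite /= inE => /eqP.
apply: preimage_closed; first by move=> g _; exact: trans_continuous.
by apply: compact_closed; [exact: norm_hausdorff|exact: compact_set1].
Qed.

Lemma affine_mxM (g k : affine R n) :
  affine_mx (g * k)%g = affine_mx g *m affine_mx k.
Proof.
rewrite /affine_mx mulmx_block aff_linM aff_transM.
by rewrite !mulmx0 !mul0mx !mulmx1 !addr0 add0r.
Qed.

Lemma affine_mx1 : affine_mx (1%g : affine R n) = 1%:M.
Proof. by rewrite /affine_mx aff_lin1 aff_trans1 -scalar_mx_block. Qed.

Lemma affine_mx_continuous : continuous (@affine_mx R n).
Proof.
apply: mx_continuousP => i j.
have cst_c (a : R) : continuous (fun _ : affine R n => a) by exact: cst_continuous.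
case: (split_ordP i) => i' ->; case: (split_ordP j) => j' ->.
- rewrite (_ : (fun _ => _) = (fun g => aff_lin g i' j')); last first.
    by apply/funext => g; rewrite block_mxEul.
  move=> g; exact: (continuous_comp (@lin_continuous R n g) (@coord_continuous _ _ _ i' j' _)).
- rewrite (_ : (fun _ => _) = (fun g => aff_trans g i' j')); last first.
    by apply/funext => g; rewrite block_mxEur.
  move=> g; exact: (continuous_comp (@trans_continuous R n g) (@coord_continuous _ _ _ i' j' _)).
- rewrite (_ : (fun _ => _) = (fun _ => 0)); first exact: cst_c.
  by apply/funext => g; rewrite block_mxEdl mxE.
- rewrite (_ : (fun _ => _) = (fun _ => (1%:M : 'M[R]_1) i' j')); first exact: cst_c.
  by apply/funext => g; rewrite block_mxEdr.
Qed.

Lemma sym_rep_continuous : continuous_representation (@sym_rep R n).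
Proof.
split.
- by apply/lfunP => S; apply/subvs_inj; rewrite sym_repE affine_mx1 id_lfunE trmx1 mul1mx mulmx1.
- move=> g k; apply/lfunP => S; apply/subvs_inj.
  by rewrite comp_lfunE !sym_repE affine_mxM trmx_mul !mulmxA.
- move=> phi S; have [M phiM] := dual_SymP phi.
  rewrite (_ : (fun g => _) = fun g =>
      \sum_i (M *m (affine_mx g *m vsval S *m (affine_mx g)^T)) i i); last first.
    by apply/funext => g; rewrite phiM /trace_form sym_repE.
  have cg := affine_mx_continuous.
  have cgt : continuous (fun g : affine R n => (affine_mx g)^T).
    by move=> g; exact: (continuous_comp (cg g) (@trmx_continuous _ _ _ _)).
  have cS : continuous (fun _ : affine R n => vsval S) by exact: cst_continuous.
  have cM : continuous (fun _ : affine R n => M) by exact: cst_continuous.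
  have c := mulmx_continuous cM (mulmx_continuous (mulmx_continuous cg cS) cgt).
  apply: continuous_big => [|i _]; first exact: add_continuous.
  by move=> g; exact: (continuous_comp (c g) (@coord_continuous _ _ _ i i _)).
Qed.

(** The image of the vector depends on the translation part of [g] only, so an element of H acts on
    it as the identity does. *)
Lemma E_last_fixed : fixed_vector (@GLsub R n) (@sym_rep R n) (E_last R n).
Proof.
have [rho1 _ _] := sym_rep_continuous.
move=> g; rewrite inE => /eqP g0.
rewrite -[RHS]id_lfunE -rho1; apply/subvs_inj.
by rewrite /= !affine_mx_E_last g0 aff_trans1.
Qed.

Local Notation h := (@homspace_trans R n).

(** The character vanishes, which leaves the linear form. The upper left block of [M] is symmetrised
    so that the integrability criterion applies to [P]. *)
Lemma densityE (theta : 'Hom(Sym R (n + 1), R^o) * (affine R n -> R)) :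
  W0 (@GLsub R n) theta.2 -> exists P q r, P^T = P /\
  density (@sym_rep R n) (E_last R n) theta =1 qexp P q r \o h.
Proof.
move=> /W0_eq0 tau0; have [M phiM] := dual_SymP theta.1.
exists (2^-1 *: (ulsubmx M + (ulsubmx M)^T)), (ursubmx M + (dlsubmx M)^T), (drsubmx M 0 0).
split; first by rewrite linearZ linearD/= trmxK addrC.
by move=> x; rewrite /density tau0 addr0 phiM trace_form_E_last /= /qexp quad_symmetrize.
Qed.

Lemma density_surj (P : 'M[R]_n) (q : 'cV[R]_n) : exists phi : 'Hom(Sym R (n + 1), R^o),
  density (@sym_rep R n) (E_last R n) (phi, fun=> 0) =1 qexp P q 0 \o h.
Proof.
(* Placing [q] in one off-diagonal block only gives the linear term without a factor 2. *)
exists (linfun (trace_form (block_mx P q 0 0))) => x.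
rewrite /density /= lfunE /= trace_form_E_last addr0 /qexp.
rewrite block_mxKul block_mxKur block_mxKdl block_mxKdr trmx0 addr0.
by have -> : (0 : 'M[R]_1) 0 0 = 0 by rewrite mxE.
Qed.

End SymmetricRepresentation.

(** * Identification with the normal family *)

Section NormalFamily.
Context (R : realType) (n : nat).
Local Notation h := (@homspace_trans R n).
Local Notation X := (homspace (@GLsub R n)).
Variable nu : {measure set (borel X) -> \bar R}.
Hypothesis nuA : admissible nu.
Local Open Scope ereal_scope.

Lemma integral_qexp (S : 'M[R]_n) (m : 'cV[R]_n) (r k : R) (A : set (borel 'cV[R]_n)) :
  (0 < k)%R -> measurable A ->
  (forall x, qexp (2^-1 *: invmx S) (- (invmx S *m m)) r x = k * normal_density S m x)%R ->
  \int[@lebesgue_cV R n]_(x in A) (qexp (2^-1 *: invmx S) (- (invmx S *m m)) r x)%:E =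
  k%:E * \int[@lebesgue_cV R n]_(x in A) (normal_density S m x)%:E.
Proof.
move=> k0 mA kE; rewrite -ge0_integralZl//.
- by apply: eq_integral => x _; rewrite kE EFinM.
- by apply/measurable_EFinP/measurable_funTS; exact: measurable_normal_density.
- by move=> x _; rewrite lee_fin normal_density_ge0.
- by rewrite lee_fin ltW.
Qed.

(** The factor [k] collects the scale of [nu] and the constant from completing the square. It
    cancels on normalisation, so the family does not depend on [nu]. *)
Lemma unnormalizedE (theta : 'Hom(Sym R (n + 1), R^o) * (affine R n -> R))
    (S : 'M[R]_n) (m : 'cV[R]_n) (r : R) : Sym_pos S ->
  density (@sym_rep R n) (E_last R n) theta =1
    qexp (2^-1 *: invmx S) (- (invmx S *m m)) r \o h ->
  exists2 k : R, (0 < k)%R & forall A : set (borel 'cV[R]_n), measurable A ->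
    unnormalized (@sym_rep R n) (E_last R n) nu theta (h @^-1` A) =
    k%:E * \int[@lebesgue_cV R n]_(x in A) (normal_density S m x)%:E.
Proof.
move=> pS dE; have [c c0 cE] := admissible_integral nuA.
have [k k0 kE] := qexp_normal_density m r pS.
exists (c * k)%R => [|A mA]; first exact: mulr_gt0.
have q0 x : (0 <= qexp (2^-1 *: invmx S) (- (invmx S *m m)) r x)%R by exact: expR_ge0.
rewrite EFinM -muleA -(integral_qexp k0 mA kE) /unnormalized (funext dE).
exact: cE (measurable_qexp _ _ _) q0 mA.
Qed.

Lemma normalized (k : R) (u : \bar R) : (0 < k)%R ->
  ((fine k%:E)^-1)%:E * (k%:E * u) = u.
Proof. by move=> k0; rewrite muleA -EFinM mulVf ?mul1e// gt_eqF. Qed.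

Lemma pushforward_method_family :
  pushforward_family h (method_family (@sym_rep R n) (E_last R n) nu) = @normal_family R n.
Proof.
apply/seteqP; split => [q [p [theta [W0t foo] pE] qE]|q [S [m [pS qE]]]].
  have [P [l [r [sP dE]]]] := densityE W0t.
  (* As [nu] is a positive multiple of Lebesgue measure, finiteness of the total mass passes to R^n
     and forces positive definiteness. *)
  have pP : Sym_pos P.
    apply: (@integrable_qexp_Sym_pos _ _ _ l r sP).
    have [c c0 cE] := admissible_integral nuA.
    have q0 x : (0 <= qexp P l r x)%R by exact: expR_ge0.
    have := cE _ setT (measurable_qexp P l r) q0 measurableT.
    move: foo; rewrite /unnormalized (funext dE) => + E; rewrite E.
    rewrite !ltey; apply: contra => /eqP ->.
    by rewrite gt0_muley ?lte_fin.
  have [S [m [pS PE lE]]] := Sym_pos_qexp l pP.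
  rewrite PE lE in dE.
  have [k k0 kE] := unnormalizedE pS dE.
  exists S, m; split => // A mA.
  rewrite qE// /pushforward pE; last exact: measurable_preimage_homspace_trans.
  rewrite -[setT]/(h @^-1` setT) !kE// integral_normal_density// mule1.
  exact: normalized.
(* Conversely, the parameter is read off from the expanded exponent of the given normal density,
   with zero character. *)
have [phi dE] := density_surj (2^-1 *: invmx S) (- (invmx S *m m)).
have [k k0 kE] := unnormalizedE pS dE.
have kT : unnormalized (@sym_rep R n) (E_last R n) nu (phi, fun=> 0%R) setT = k%:E.
  by rewrite -[setT]/(h @^-1` setT) kE// integral_normal_density// mule1.
(* The given law [q], carried back to G/H by the inverse of the coordinate. *)
pose p : {measure set (borel X) -> \bar R} :=
  @image_measure _ _ (borel 'cV[R]_n) (borel X) R q (@homspace_of R n) (@measurable_homspace_of R n).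
have pE A : p A = q (@homspace_of R n @^-1` A) by [].
exists p; last by move=> A mA; rewrite /pushforward pE preimage_homspace_transK.
exists (phi, fun=> 0%R).
  split; last by rewrite kT ltry.
  by split => // [|x y]; [exact: cst_continuous|rewrite addr0].
move=> A mA; rewrite pE qE; last exact: measurable_preimage_homspace_of.
rewrite kT -[in RHS](preimage_homspace_ofK A) kE; last exact: measurable_preimage_homspace_of.
by rewrite normalized.
Qed.

End NormalFamily.

(** Existence of an admissible [nu] is part of the claim, which keeps the last clause from being
    vacuous. *)
Theorem proposition4p4 (R : realType) (n : nat) (hn : (0 < n)%N) :
  [/\ closed [set g : affine R n | g \in @GLsub R n],
      continuous_representation (@sym_rep R n),
      fixed_vector (@GLsub R n) (@sym_rep R n) (E_last R n),
      exists nu : {measure set (borel (homspace (@GLsub R n))) -> \bar R},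
        admissible nu
    & forall nu : {measure set (borel (homspace (@GLsub R n))) -> \bar R},
        admissible nu ->
        pushforward_family (@homspace_trans R n)
          (method_family (@sym_rep R n) (E_last R n) nu)
        = @normal_family R n].
Proof.
split.
- exact: GLsub_closed.
- exact: sym_rep_continuous.
- exact: E_last_fixed.
- by exists (homspace_lebesgue R n); exact: homspace_lebesgue_admissible.
- by move=> nu; exact: pushforward_method_family.
Qed.
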